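(* Let $\rho\in W(0,T;\mathbb{H}^s_0(\Omega))$ be the weak solution of $$\rho_t+(-\Delta)^s\rho=f\ \text{ in }Q,\qquad \rho=0\ \text{ in }\Sigma,\qquad \rho(\cdot,0)=\rho_0\ \text{ in }\Omega,$$ corresponding to data $f\in L^2(Q)$ and $\rho_0\in L^2(\Omega)$, and let $\tilde\rho\in W(0,T;\mathbb{H}^s_0(\Omega))$ be the weak solution of the same problem with $f,\rho_0$ replaced by data $\tilde f\in L^2(Q)$ and $\tilde\rho_0\in L^2(\Omega)$. If $\rho_0\le\tilde\rho_0$ almost everywhere in $\Omega$ and $f\le\tilde f$ almost everywhere in $Q$, then $\rho\le\tilde\rho$ almost everywhere in $\mathbb{R}^N\times[0,T]$. In particular, if $f\ge 0$ and $\rho_0\ge 0$ almost everywhere, then $\rho\ge 0$ almost everywhere in $\mathbb{R}^N\times[0,T]$.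
   Context: Setting: $N\ge 1$, $\Omega\subset\mathbb{R}^N$ is a bounded open domain with Lipschitz continuous boundary, $0<s<1$, $T>0$, $Q=\Omega\times(0,T)$, $\Sigma=(\mathbb{R}^N\setminus\Omega)\times(0,T)$, and $C_{N,s}=\frac{s2^{2s}\Gamma((2s+N)/2)}{\pi^{N/2}\Gamma(1-s)}$. Formally, $(-\Delta)^s w(x)=C_{N,s}\,\mathrm{P.V.}\int_{\mathbb{R}^N}\frac{w(x)-w(y)}{|x-y|^{N+2s}}\,dy$. Spaces: $\mathbb{H}^s_0(\Omega)=\{\rho\in H^s(\mathbb{R}^N):\rho=0\text{ in }\mathbb{R}^N\setminus\Omega\}$ is a Hilbert space with norm $\|\rho\|_{\mathbb{H}^s_0(\Omega)}=\mathcal{F}(\rho,\rho)^{1/2}$, where $$\mathcal{F}(\rho,\psi)=\frac{C_{N,s}}{2}\int_{\mathbb{R}^N}\int_{\mathbb{R}^N}\frac{(\rho(x)-\rho(y))(\psi(x)-\psi(y))}{|x-y|^{N+2s}}\,dx\,dy.$$ $\mathbb{H}^{-s}(\Omega)$ is its dual with respect to the pivot space $L^2(\Omega)$. $W(0,T;\mathbb{H}^s_0(\Omega))=\{\zeta\in L^2(0,T;\mathbb{H}^s_0(\Omega)):\zeta_t\in L^2(0,T;\mathbb{H}^{-s}(\Omega))\}$ embeds continuously in $C([0,T];L^2(\Omega))$, so values at fixed times make sense in $L^2(\Omega)$. Let $H(Q)=\{\xi\in W(0,T;\mathbb{H}^s_0(\Omega)):\xi(\cdot,T)=0\text{ a.e.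 in }\Omega\}$. Weak solution: for $f\in L^2(Q)$, $\rho_0\in L^2(\Omega)$, the weak solution is the unique $\rho\in W(0,T;\mathbb{H}^s_0(\Omega))$ such that for all $\phi\in H(Q)$, $$-\int_0^T\langle\phi_t,\rho\rangle_{\mathbb{H}^{-s}(\Omega),\mathbb{H}^s_0(\Omega)}\,dt+\int_0^T\mathcal{F}(\rho,\phi)\,dt=\int_Q f\phi\,dx\,dt+\int_\Omega\rho_0\,\phi(\cdot,0)\,dx.$$ *)

(* Defs.v *)
From HB Require Import structures.
From mathcomp Require Import all_boot all_order all_algebra.
From mathcomp Require Import all_classical all_reals all_analysis.

Set Implicit Arguments.
Unset Strict Implicit.
Unset Printing Implicit Defensive.
Import Order.TTheory GRing.Theory Num.Theory.
Import numFieldNormedType.Exports.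

Local Open Scope classical_set_scope.
Local Open Scope ring_scope.

(* The sigma-algebra generated by the coordinates, i.e. the Borel
   sigma-algebra of R^n; same construction as the library's n.-tuple R. *)
Section measurable_rV.
Context (R : realType) (n : nat).

Definition rV_coord (i : 'I_n) (x : 'rV[R]_n) : R := x ord0 i.

Let rV_set0 : g_sigma_preimage rV_coord set0.
Proof. exact: sigma_algebra0. Qed.

Let rV_setC A : g_sigma_preimage rV_coord A -> g_sigma_preimage rV_coord (~` A).
Proof. exact: sigma_algebraC. Qed.

Let rV_bigcup (F : _^nat) : (forall i, g_sigma_preimage rV_coord (F i)) ->
  g_sigma_preimage rV_coord (\bigcup_i (F i)).
Proof. exact: sigma_algebra_bigcup. Qed.

HB.instance Definition _ := @isMeasurable.Build default_measure_display
  'rV[R]_n (g_sigma_preimage rV_coord) rV_set0 rV_setC rV_bigcup.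

End measurable_rV.

(* Cavalieri's principle, the 0-dimensional Lebesgue measure being the Dirac
   mass of the one-point space R^0. *)
Fixpoint lebesgue_rV (R : realType) (n : nat) : set 'rV[R]_n -> \bar R :=
  match n with
  | 0 => fun A => (\1_A (0 : 'rV[R]_0))%:E
  | m.+1 => fun A => (\int[lebesgue_measure]_x
      lebesgue_rV [set v : 'rV[R]_m | A (row_mx (x%:M : 'rV[R]_1) v)])%E
  end.

Section lebesgue_rV_measure.
Context (R : realType).

Let cons_rV n (p : measurableTypeR R * 'rV[R]_n) : 'rV[R]_n.+1 :=
  row_mx (p.1%:M : 'rV[R]_1) p.2.

Let split_rV n (x : 'rV[R]_n.+1) : measurableTypeR R * 'rV[R]_n :=
  (x ord0 ord0, \row_j x ord0 (lift ord0 j)).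

Let cons_rV0 n (p : measurableTypeR R * 'rV[R]_n) : cons_rV p ord0 ord0 = p.1.
Proof.
transitivity (row_mx (p.1%:M : 'rV[R]_1) p.2 ord0 (lshift n ord0)).
  by congr (_ _ _); exact/val_inj.
by rewrite row_mxEl mxE eqxx mulr1n.
Qed.

Let cons_rVS n (p : measurableTypeR R * 'rV[R]_n) j :
  cons_rV p ord0 (lift ord0 j) = p.2 ord0 j.
Proof.
transitivity (row_mx (p.1%:M : 'rV[R]_1) p.2 ord0 (rshift 1 j)).
  by congr (_ _ _); exact/val_inj.
by rewrite row_mxEr.
Qed.

Let cons_rVK n : cancel (@cons_rV n) (@split_rV n).
Proof.
move=> p; rewrite /split_rV cons_rV0; case: p => x v; congr pair.
by apply/rowP => j; rewrite mxE cons_rVS.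
Qed.

Let measurable_coord n (i : 'I_n) :
  measurable_fun [set: 'rV[R]_n] (fun x => x ord0 i : R).
Proof.
move=> _ Y mY; rewrite setTI; apply: sub_sigma_algebra => /=.
rewrite -bigcup_seq/=; exists i => /=; first by rewrite mem_index_enum.
by exists Y => //; rewrite setTI.
Qed.

Let measurable_to_rV d (T : measurableType d) n (f : T -> 'rV[R]_n) :
  (forall i, measurable_fun [set: T] (fun t => f t ord0 i : R)) ->
  measurable_fun [set: T] f.
Proof.
move=> mf.
have sub : g_sigma_preimage (@rV_coord R n) `<=`
    image_set_system [set: T] f measurable.
  apply: smallest_sub.
    exact/sigma_algebra_image/sigma_algebra_measurable.
  rewrite -bigcup_seq/= => B [i _ [Y mY <-]] /=.
  rewrite /image_set_system/= !setTI -comp_preimage -[X in measurable X]setTI.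
  exact: mf.
by move=> _ Y mY; have := sub _ mY.
Qed.

Let measurable_cons_rV n : measurable_fun setT (@cons_rV n).
Proof.
apply: measurable_to_rV => i; case: (unliftP ord0 i) => [j ->|->].
  under eq_fun do rewrite cons_rVS.
  by apply: (measurableT_comp (measurable_coord j)); exact: measurable_snd.
under eq_fun do rewrite cons_rV0.
exact: measurable_fst.
Qed.

Let measurable_split_rV n : measurable_fun setT (@split_rV n).
Proof.
apply/measurable_fun_pairP; split; first exact: measurable_coord.
apply: measurable_to_rV => i.
rewrite [X in measurable_fun _ X](_ : _ = fun x : 'rV[R]_n.+1 => x ord0 (lift ord0 i)).
  exact: measurable_coord.
by apply/funext => x /=; rewrite mxE.
Qed.

Let dirac_rV0 (A : set 'rV[R]_0) : @lebesgue_rV R 0 A = \d_(0 : 'rV[R]_0) A.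
Proof. by []. Qed.

Let step n (m : {sigma_finite_measure set 'rV[R]_n -> \bar R}) :=
  pushforward (@lebesgue_measure R \x m)%E (@cons_rV n).

Let step_sigma_finite n (m : {sigma_finite_measure set 'rV[R]_n -> \bar R}) :
  sigma_finite setT (step m).
Proof.
have /sigma_finiteP[F [FT ndF Foo]] := sigma_finiteT (@lebesgue_measure R).
have /sigma_finiteP[G [GT ndG Goo]] := sigma_finiteT m.
have mFG k : measurable (F k `*` G k).
  by apply: measurableX; [case: (Foo k)|case: (Goo k)].
exists (fun k => @split_rV n @^-1` (F k `*` G k)).
  rewrite -preimage_bigcup (_ : \bigcup_k _ = setT) ?preimage_setT//.
  apply/seteqP; split => // -[x v] _.
  have [i _ Fix] : (\bigcup_k F k) x by rewrite -FT.
  have [j _ Gjv] : (\bigcup_k G k) v by rewrite -GT.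
  exists (maxn i j) => //; split => /=.
    by move: x Fix; exact/subsetPset/ndF/leq_maxl.
  by move: v Gjv; exact/subsetPset/ndG/leq_maxr.
move=> k; split.
  by rewrite -[X in measurable X]setTI; exact: measurable_split_rV.
rewrite /step /pushforward -comp_preimage (_ : _ \o _ = id); last first.
  exact/funext/cons_rVK.
have [mF Fk] := Foo k; have [mG Gk] := Goo k.
by rewrite preimage_id product_measure1E// lte_mul_pinfty// ge0_fin_numE.
Qed.

Lemma lebesgue_rV_sigma_finite_measure n :
  {m : {sigma_finite_measure set 'rV[R]_n -> \bar R} | @lebesgue_rV R n = m}.
Proof.
elim: n => [|n [m mE]].
  exists [the {sigma_finite_measure set _ -> \bar R} of \d_(0 : 'rV[R]_0)].
  by apply/funext => A; rewrite dirac_rV0.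
pose pm : {measure set (measurableTypeR R * 'rV[R]_n)%type -> \bar R} :=
  (lebesgue_measure \x m)%E.
pose pf : {measure set 'rV[R]_n.+1 -> \bar R} :=
  measure_function_pushforward__canonical__measure_function_Measure
    pm (@measurable_cons_rV n).
pose pfs := Measure_isSigmaFinite.Build _ _ _ pf (step_sigma_finite m).
pose m' : {sigma_finite_measure set _ -> \bar R} :=
  HB.pack (Measure.sort pf) pfs.
exists m'; apply/funext => A; rewrite /= /pushforward /product_measure1 mE.
apply: eq_integral => x _ /=; congr (m _).
by apply/seteqP; split => v /=; rewrite /xsection /= inE.
Qed.

Let lebesgue_rV_set0 n : @lebesgue_rV R n set0 = 0%E.
Proof. by have [m ->] := lebesgue_rV_sigma_finite_measure n. Qed.

Let lebesgue_rV_ge0 n A : (0 <= @lebesgue_rV R n A)%E.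
Proof. by have [m ->] := lebesgue_rV_sigma_finite_measure n. Qed.

Let lebesgue_rV_sigma_additive n : semi_sigma_additive (@lebesgue_rV R n).
Proof.
have [m ->] := lebesgue_rV_sigma_finite_measure n.
exact: measure_semi_sigma_additive.
Qed.

HB.instance Definition _ n := isMeasure.Build _ _ _ (@lebesgue_rV R n)
  (@lebesgue_rV_set0 n) (@lebesgue_rV_ge0 n) (@lebesgue_rV_sigma_additive n).

Let lebesgue_rV_sigma_finite n : sigma_finite setT (@lebesgue_rV R n).
Proof.
have [m ->] := lebesgue_rV_sigma_finite_measure n.
exact: sigma_finiteT.
Qed.

HB.instance Definition _ n := Measure_isSigmaFinite.Build _ _ _
  (@lebesgue_rV R n) (@lebesgue_rV_sigma_finite n).

End lebesgue_rV_measure.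

Definition Gamma (R : realType) (z : R) : R :=
  \int[lebesgue_measure]_(t in `]0, +oo[) (t `^ (z - 1) * expR (- t)).

(* The library's norm on 'rV[R]_n is the sup norm. *)
Definition enorm (R : realType) (n : nat) (x : 'rV[R]_n) : R :=
  Num.sqrt (\sum_(i < n) x ord0 i ^+ 2).

Section lipschitz_domain.
Context (R : realType) (N : nat).

(* In the orthogonal coordinates y = x *m U, the set is near x0 the strict
   epigraph of a Lipschitz function of the coordinates of y other than y_i. *)
Definition lipschitz_epigraph_near (Omega : set 'rV[R]_N) (x0 : 'rV[R]_N) :=
  exists (U : 'M[R]_N) (i : 'I_N) (gamma : 'rV[R]_N.-1 -> R) (r : R),
    [/\ U *m U^T = 1%:M, lipschitz (gamma : 'rV[R]_N.-1 -> R^o), 0 < r &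
      forall x, enorm (x - x0) < r ->
        (Omega x <-> gamma (col' i (x *m U)) < (x *m U) ord0 i)].

Definition lipschitz_boundary (Omega : set 'rV[R]_N) :=
  forall x0, (closure Omega `\` interior Omega) x0 ->
    lipschitz_epigraph_near Omega x0.

Definition bounded_lipschitz_domain (Omega : set 'rV[R]_N) :=
  [/\ Omega !=set0, open Omega, connected Omega, bounded_set Omega &
    lipschitz_boundary Omega].

End lipschitz_domain.

Section fractional_sobolev.
Context (R : realType) (N : nat) (Omega : set 'rV[R]_N) (s : R).
Local Notation leb := (@lebesgue_rV R N).

Definition C_Ns : R :=
  s * 2 `^ (2 * s) * Gamma ((2 * s + N%:R) / 2) /
  (pi `^ (N%:R / 2) * Gamma (1 - s)).

Definition kernel_form (u v : 'rV[R]_N -> R) (z : 'rV[R]_N * 'rV[R]_N) : R :=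
  (u z.1 - u z.2) * (v z.1 - v z.2) / enorm (z.1 - z.2) `^ (N%:R + 2 * s).

Definition Fform (u v : 'rV[R]_N -> R) : R :=
  C_Ns / 2 * \int[(leb \x leb)%E]_z kernel_form u v z.

Definition Hs : set ('rV[R]_N -> R) :=
  [set u | u \in Lfun leb 2%:E /\
    (\int[(leb \x leb)%E]_z (kernel_form u u z)%:E < +oo)%E].

Definition Hs0 : set ('rV[R]_N -> R) :=
  [set u | Hs u /\ {ae leb, forall x, ~ Omega x -> u x = 0}].

Definition Hs0_norm (u : 'rV[R]_N -> R) : R := Num.sqrt (Fform u u).

(* H^{-s}: a functional is only constrained on Hs0, so that functionals which
   agree on Hs0 represent the same element (their difference has norm 0). *)
Definition Hs0_dual : set (('rV[R]_N -> R) -> R) :=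
  [set l | (forall (a : R) u v, Hs0 u -> Hs0 v ->
              l (fun x => a * u x + v x) = a * l u + l v) /\
           exists C, forall u, Hs0 u -> `|l u| <= C * Hs0_norm u].

Definition Hs0_dual_norm (l : ('rV[R]_N -> R) -> R) : R :=
  sup [set `|l u| | u in [set u | Hs0 u /\ Hs0_norm u <= 1]].

Definition L2_Omega : set ('rV[R]_N -> R) :=
  [set u | u \_ Omega \in Lfun leb 2%:E].

Definition L2_Omega_norm (u : 'rV[R]_N -> R) : \bar R :=
  Lnorm leb 2%:E (EFin \o (u \_ Omega)).

End fractional_sobolev.

Section bochner.
Context (R : realType) (T : R) (V : zmodType) (X : set V) (nrm : V -> R).

Definition simple_curve (u : R -> V) :=
  [/\ finite_set (range u), (forall t, X (u t)) &
    forall v, measurable (u @^-1` [set v] : set R)].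

Definition strongly_measurable (u : R -> V) :=
  exists2 u_ : nat -> R -> V, (forall n, simple_curve (u_ n)) &
    {ae lebesgue_measure, forall t : R, 0 < t < T ->
      nrm (u_ n t - u t) @[n --> \oo] --> (0 : R)}.

(* L^2(0, T; X), the norm of X being nrm. *)
Definition bochner_L2 (u : R -> V) :=
  [/\ {ae lebesgue_measure, forall t : R, 0 < t < T -> X (u t)},
      strongly_measurable u &
      (\int[lebesgue_measure]_(t in `]0%R, T[) (nrm (u t) ^+ 2)%:E < +oo)%E].

End bochner.

Section fractional_heat.
Context (R : realType) (N : nat) (Omega : set 'rV[R]_N) (s T : R).
Local Notation leb := (@lebesgue_rV R N).
Local Notation L1 := (@lebesgue_measure R).

Definition at_time (zeta : 'rV[R]_N * R -> R) (t : R) : 'rV[R]_N -> R :=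
  fun x => zeta (x, t).

Definition cylinder : set ('rV[R]_N * R) := Omega `*` `]0, T[.

Definition L2_Q (f : 'rV[R]_N * R -> R) :=
  f \_ cylinder \in Lfun (leb \x L1)%E 2%:E.

(* An element of L^2(0, T; H^s_0) is given by a representative which is
   jointly measurable on R^N x (0, T). *)
Definition L2_Hs0 (zeta : 'rV[R]_N * R -> R) :=
  measurable_fun (setT `*` `]0, T[) zeta /\
  bochner_L2 T (Hs0 Omega s) (Hs0_norm s) (at_time zeta).

Definition L2_Hs0_dual (z : R -> ('rV[R]_N -> R) -> R) :=
  bochner_L2 T (Hs0_dual Omega s) (Hs0_dual_norm Omega s) z.

(* C_c^oo(0, T) *)
Definition test_function (eta : R -> R) :=
  (forall n t, derivable (derive1n n eta) t 1) /\
  exists a b, [/\ 0 < a, b < T & forall t, ~~ (a <= t <= b) -> eta t = 0].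

(* z = zeta_t as distributions with values in H^{-s}; both sides are vector
   integrals in H^{-s}, hence are compared on each v in H^s_0, and zeta(t)
   is viewed in H^{-s} through the pivot space L^2(Omega). *)
Definition time_derivative (zeta : 'rV[R]_N * R -> R)
    (z : R -> ('rV[R]_N -> R) -> R) :=
  forall eta v, test_function eta -> Hs0 Omega s v ->
    \int[L1]_(t in `]0, T[)
      ((\int[leb]_(x in Omega) (zeta (x, t) * v x)) * derive1 eta t) =
    - \int[L1]_(t in `]0, T[) (z t v * eta t).

Definition W (zeta : 'rV[R]_N * R -> R) :=
  L2_Hs0 zeta /\
  exists2 z, L2_Hs0_dual z & time_derivative zeta z.

Definition continuous_L2 (c : R -> 'rV[R]_N -> R) :=
  (forall t, 0 <= t <= T -> L2_Omega Omega (c t)) /\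
  forall t0, 0 <= t0 <= T ->
    L2_Omega_norm Omega (c t - c t0) @[t --> within `[0, T] (nbhs t0)] --> 0%E.

(* g is the value at time t0 of the representative of zeta lying in
   C([0, T]; L^2(Omega)). *)
Definition time_value (zeta : 'rV[R]_N * R -> R) (t0 : R)
    (g : 'rV[R]_N -> R) :=
  exists c, [/\ continuous_L2 c,
    {ae L1, forall t : R, 0 < t < T ->
      {ae leb, forall x, Omega x -> c t x = zeta (x, t)}} &
    {ae leb, forall x, Omega x -> c t0 x = g x}].

Definition HQ (xi : 'rV[R]_N * R -> R) := W xi /\ time_value xi T (cst 0).

Definition weak_solution (f : 'rV[R]_N * R -> R) (rho0 : 'rV[R]_N -> R)
    (rho : 'rV[R]_N * R -> R) :=
  W rho /\
  forall phi phi_t phi0, HQ phi ->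
    L2_Hs0_dual phi_t -> time_derivative phi phi_t ->
    time_value phi 0 phi0 ->
    - (\int[L1]_(t in `]0, T[) phi_t t (at_time rho t)) +
      \int[L1]_(t in `]0, T[) Fform s (at_time rho t) (at_time phi t) =
    \int[(leb \x L1)%E]_(p in cylinder) (f p * phi p) +
      \int[leb]_(x in Omega) (rho0 x * phi0 x).

End fractional_heat.

(* Main.v *)
From HB Require Import structures.
Require Import Defs.
From mathcomp Require Import all_boot all_order all_algebra.
From mathcomp Require Import all_classical all_reals all_analysis.
From mathcomp Require Import measurable_realfun ring lra.
Import Order.TTheory GRing.Theory Num.Theory.
Import numFieldNormedType.Exports.
Set Implicit Arguments.
Unset Strict Implicit.
Unset Printing Implicit Defensive.
Local Open Scope classical_set_scope.
Local Open Scope ring_scope.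

(** Let [u] be the difference [rho' - rho] of the two solutions, or [rho]
itself for the last claim, extended by [0] outside [0 < t < T].  The textbook
proof tests the equation with the negative part of [u], which requires a chain
rule for curves whose derivative only lives in the dual space [H^{-s}].  Here
the regularity in time is produced by convolution, so that no chain rule is
needed.

Testing with the separated functions [eta t * v x], where [v >= 0] belongs to
[H^s_0] and [eta >= 0] is [C^1] with [eta T = 0], the data only contribute
nonnegative terms ([supersolution_of_difference]), and Fubini's theorem moves
the integral in time onto [u]: with [tavg h u x] the integral of
[h t * u (x, t)] in [t],
[0 <= - \int v * tavg eta' u + F (v, tavg eta u)] ([supersolution]).
By Cauchy-Schwarz in time such averages lie in [H^s_0] ([tavg_Hs0]).

Take [eta = k (t - .)] with [k >= 0] vanishing on the negative half-line, so
that [eta T = 0] as soon as [t <= T].  The averages become the smoothed curve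
[w(t) = \int k(t - r) u(r) dr] and its derivative [w'(t)], and [v] may be the
negative part [w(t)^-].  Since
[(w(x)^- - w(y)^-) * (w(x) - w(y)) <= 0], the form [F (w^-, w)] is nonpositive
and [\int w(t)^- w'(t) >= 0] ([smoothed_dissipation]).  Consequently
[E(t) = \int (w(t)^-)^2] decreases up to a quadratic error,
[E(t + h) <= E(t) + C h^2] for all [h >= 0] ([energy_increment]).  As
[E(0) = 0], adding [n] steps of length [t / n] yields [E(t) <= C t^2 / n] for
all [n], that is [E(t) = 0] and [w(t) >= 0] ([smoothed_ge0]).

It remains to undo the smoothing: piecewise quadratic kernels [k] approach
the indicator of an interval, so that for almost every [x] the integral of
[u (x, .)] over every interval with rational endpoints in [0, T] is
nonnegative, and Lebesgue's differentiation theorem gives [u >= 0] almost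
everywhere ([supersolution_ge0]).

Admissibility of the test functions is the other half of the work.  The
functionals [u |-> eta' t * \int v u] must belong to [H^{-s}], which needs the
fractional Poincare inequality ([poincare]) and the positivity of the constant
[C_{N,s}] ([C_Ns_gt0]); the same inequality makes the solutions square
integrable in space-time ([L2_Hs0_finite_energy]), as required by Fubini's
theorem. *)
(** * Square-integrable functions *)

Section square_integrable.
Context d (T : measurableType d) (R : realType) (mu : {measure set T -> \bar R}).
Implicit Types f g : T -> R.

Definition sqint f :=
  measurable_fun setT f /\ (\int[mu]_x (f x ^+ 2)%:E < +oo)%E.

Lemma Lfun2P f : f \in Lfun mu 2%:E <-> sqint f.
Proof.
split=> [fL|[mf fi]].
  split; first by move: fL; rewrite inE => /andP[]; rewrite inE.
  have /integrableP[_] := Lfun2_integrable_sqr fL.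
  by under eq_integral => x _ do rewrite /= ger0_norm ?sqr_ge0//.
rewrite inE; apply/andP; split; rewrite inE//= /finite_norm unlock.
rewrite poweR_lty//; under eq_integral => x _ do
  rewrite /= powR_mulrn// -normrX ger0_norm ?sqr_ge0//.
exact: fi.
Qed.

Lemma sqint_le f g : measurable_fun setT f -> (forall x, `|f x| <= `|g x|) ->
  sqint g -> sqint f.
Proof.
move=> mf fg [mg gi]; split=> //; apply: le_lt_trans gi.
apply: ge0_le_integral => //.
- by move=> x _; rewrite lee_fin sqr_ge0.
- by apply/measurable_EFinP; exact: measurable_funX.
- by apply/measurable_EFinP; exact: measurable_funX.
- by move=> x _; rewrite lee_fin -(real_normK (num_real (f x)))
    -(real_normK (num_real (g x))) ler_pXn2r// nnegrE.
Qed.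

Lemma sqintZ f k : sqint f -> sqint (fun x => k * f x).
Proof.
move=> [mf fi]; split; first exact: measurable_funM.
under eq_integral => x _ do rewrite exprMn EFinM.
rewrite ge0_integralZl//.
- by rewrite lte_mul_pinfty// ?lee_fin ?sqr_ge0.
- by apply/measurable_EFinP; exact: measurable_funX.
- by move=> x _; rewrite lee_fin sqr_ge0.
- by rewrite lee_fin sqr_ge0.
Qed.

Lemma sqintD f g : sqint f -> sqint g -> sqint (fun x => f x + g x).
Proof.
move=> [mf fi] [mg gi]; split; first exact: measurable_funD.
have mf2 : measurable_fun setT (fun x => (f x ^+ 2)%:E).
  by apply/measurable_EFinP; exact: measurable_funX.
have mg2 : measurable_fun setT (fun x => (g x ^+ 2)%:E).
  by apply/measurable_EFinP; exact: measurable_funX.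
apply: (@le_lt_trans _ _
  (\int[mu]_x (2%:E * (f x ^+ 2)%:E + 2%:E * (g x ^+ 2)%:E))%E).
  apply: ge0_le_integral => //.
  - by move=> x _; rewrite lee_fin sqr_ge0.
  - by apply/measurable_EFinP; apply: measurable_funX; exact: measurable_funD.
  - by apply: emeasurable_funD; exact: measurable_funeM.
  - move=> x _; rewrite -!EFinM -EFinD lee_fin.
    by have := sqr_ge0 (f x - g x); rewrite sqrrB sqrrD; lra.
rewrite ge0_integralD//; last first.
- exact: measurable_funeM.
- by move=> x _; rewrite -EFinM lee_fin mulr_ge0 ?sqr_ge0.
- exact: measurable_funeM.
- by move=> x _; rewrite -EFinM lee_fin mulr_ge0 ?sqr_ge0.
rewrite !ge0_integralZl//.
- by apply: lte_add_pinfty; rewrite lte_mul_pinfty// lee_fin.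
- by move=> x _; rewrite lee_fin sqr_ge0.
- by move=> x _; rewrite lee_fin sqr_ge0.
Qed.

Lemma sqintB f g : sqint f -> sqint g -> sqint (fun x => f x - g x).
Proof.
move=> sf sg; have := sqintD sf (sqintZ (-1) sg).
by congr sqint; apply/funext => x; rewrite mulN1r.
Qed.

Lemma sqint_integrable_sqr f : sqint f ->
  mu.-integrable setT (fun x => (f x ^+ 2)%:E).
Proof.
move=> [mf fi]; apply/integrableP; split.
  by apply/measurable_EFinP; exact: measurable_funX.
by under eq_integral => x _ do rewrite /= ger0_norm ?sqr_ge0//.
Qed.

Lemma sqintM f g : sqint f -> sqint g ->
  mu.-integrable setT (fun x => (f x * g x)%:E).
Proof.
move=> sf sg; have [mf _] := sf; have [mg _] := sg.
have := integrableD measurableT (sqint_integrable_sqr sf)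
  (sqint_integrable_sqr sg).
apply: le_integrable => //.
  by apply/measurable_EFinP; exact: measurable_funM.
move=> x _; rewrite !abse_EFin lee_fin normrM.
apply: le_trans (ler_norm _).
rewrite -(real_normK (num_real (f x))) -(real_normK (num_real (g x))).
move: `|f x| `|g x| (normr_ge0 (f x)) (normr_ge0 (g x)) => a b a0 b0.
by have := sqr_ge0 (a - b); have := mulr_ge0 a0 b0; rewrite sqrrB; lra.
Qed.

Lemma sqint_restrict A f : measurable A -> sqint f -> sqint (f \_ A).
Proof.
move=> mA sf; apply: (sqint_le _ _ sf).
  by apply/(measurable_restrictT _ mA); apply: measurable_funTS; case: sf.
by move=> x; rewrite patchE; case: ifP => //; rewrite normr0.
Qed.

End square_integrable.

Section cauchy_schwarz.
Context d (T : measurableType d) (R : realType) (mu : {measure set T -> \bar R}).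
Implicit Types f g : T -> R.

(** The quadratic form [(p, q) |-> \int (p f + q g)^2] is nonnegative, so its
discriminant is nonpositive. *)
Lemma Rintegral_cauchy_schwarz f g : sqint mu f -> sqint mu g ->
  (\int[mu]_x (f x * g x)) ^+ 2 <=
  (\int[mu]_x (f x ^+ 2)) * (\int[mu]_x (g x ^+ 2)).
Proof.
move=> sf sg.
have If := sqint_integrable_sqr sf; have Ig := sqint_integrable_sqr sg.
have Ifg := sqintM sf sg.
set a := \int[mu]_x (f x ^+ 2); set c := \int[mu]_x (g x ^+ 2).
set b := \int[mu]_x (f x * g x).
have quad p q : 0 <= p ^+ 2 * a + 2 * p * q * b + q ^+ 2 * c.
  have -> : p ^+ 2 * a + 2 * p * q * b + q ^+ 2 * c =
      \int[mu]_x ((p * f x + q * g x) ^+ 2).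
    rewrite -(RintegralZl _ measurableT If) -(RintegralZl _ measurableT Ifg).
    rewrite -(RintegralZl _ measurableT Ig).
    rewrite -RintegralD//; last 2 first.
    - by have := integrableZl measurableT (p ^+ 2) If.
    - by have := integrableZl measurableT (2 * p * q) Ifg.
    rewrite -RintegralD//; last 2 first.
    - have := integrableD measurableT (integrableZl measurableT (p ^+ 2) If)
        (integrableZl measurableT (2 * p * q) Ifg).
      by [].
    - by have := integrableZl measurableT (q ^+ 2) Ig.
    by apply: eq_Rintegral => x _; ring.
  by apply: Rintegral_ge0 => x _; exact: sqr_ge0.
have a0 : 0 <= a by apply: Rintegral_ge0 => x _; exact: sqr_ge0.
have c0 : 0 <= c by apply: Rintegral_ge0 => x _; exact: sqr_ge0.
have [a_eq0|a_neq0] := eqVneq a 0.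
  (* If [f = 0] almost everywhere, the form is affine in [p] for [q = b], and
     [p = - (c + 1)] gives [- (c + 2) b^2 >= 0]. *)
  have := quad (- (c + 1)) b; rewrite a_eq0; nra.
have {}a0 : 0 < a by rewrite lt0r a_neq0.
have := quad b (- a).
have -> : b ^+ 2 * a + 2 * b * - a * b + (- a) ^+ 2 * c = a * (a * c - b ^+ 2).
  by ring.
by rewrite pmulr_rge0// subr_ge0.
Qed.

End cauchy_schwarz.

(** * Null sets and integrals for product measures *)

Section ae_filter.
Context d (T : measurableType d) (R : realType) (mu : {measure set T -> \bar R}).

(** Restatements of filter monotonicity with the measure as the only filter
that unification has to guess. *)
Lemma ae_imp (P Q : T -> Prop) : (forall x, P x -> Q x) ->
  {ae mu, forall x, P x} -> {ae mu, forall x, Q x}.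
Proof. by move=> PQ; apply: filterS. Qed.

Lemma ae_imp2 (P P' Q : T -> Prop) : (forall x, P x -> P' x -> Q x) ->
  {ae mu, forall x, P x} -> {ae mu, forall x, P' x} -> {ae mu, forall x, Q x}.
Proof. by move=> PQ; apply: filterS2. Qed.

End ae_filter.

Section product_sigma_finite.
Context d1 d2 (T1 : measurableType d1) (T2 : measurableType d2) (R : realType).
Variable m1 : {sigma_finite_measure set T1 -> \bar R}.
Variable m2 : {sigma_finite_measure set T2 -> \bar R}.

Lemma sigma_finite_product : sigma_finite setT (m1 \x m2)%E.
Proof.
have /sigma_finiteP[F [FT ndF Foo]] := sigma_finiteT m1.
have /sigma_finiteP[G [GT ndG Goo]] := sigma_finiteT m2.
exists (fun n => F n `*` G n).
  apply/seteqP; split=> [[x y] _|//].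
  have [i _ Fx] : (\bigcup_n F n) x by rewrite -FT.
  have [j _ Gy] : (\bigcup_n G n) y by rewrite -GT.
  exists (maxn i j) => //; split => /=.
    by move: x Fx; exact/subsetPset/ndF/leq_maxl.
  by move: y Gy; exact/subsetPset/ndG/leq_maxr.
move=> n; have [mF Fn] := Foo n; have [mG Gn] := Goo n.
split; first exact: measurableX.
by rewrite product_measure1E// lte_mul_pinfty// ge0_fin_numE.
Qed.

(** The product measure with its sigma-finiteness packaged, so that Fubini's
theorem applies to a further product such as [(R^N * R^N) * R]. *)
Definition product_sfm : {sigma_finite_measure set (T1 * T2)%type -> \bar R} :=
  let pm := [the measure _ _ of (m1 \x m2)%E] in
  HB.pack (Measure.sort pm)
    (Measure_isSigmaFinite.Build _ _ _ pm sigma_finite_product).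

End product_sigma_finite.

Section ae_product.
Context d1 d2 (T1 : measurableType d1) (T2 : measurableType d2) (R : realType).
Variable m1 : {sigma_finite_measure set T1 -> \bar R}.
Variable m2 : {sigma_finite_measure set T2 -> \bar R}.

(** Uniqueness of the product measure: both orders of slicing agree on
rectangles. *)
Lemma product_measure_swap A : measurable A ->
  (m1 \x m2)%E A = (\int[m2]_y m1 (ysection A y))%E.
Proof.
move=> mA; have /= -> // := @product_measure_unique _ _ _ _ _ m1 m2 (m1 \x^ m2)%E _ A mA.
by move=> A1 A2 mA1 mA2; rewrite /= product_measure2E.
Qed.

Lemma product_null_x A : measurable A ->
  (m1 \x m2)%E A = 0%E <-> {ae m1, forall x, m2 (xsection A x) = 0%E}.
Proof.
move=> mA; have mf := measurable_fun_xsection m2 mA.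
have abs : (\int[m1]_x `|(m2 \o xsection A) x|)%E = (m1 \x m2)%E A.
  by apply: eq_integral => x _; rewrite gee0_abs.
split=> [A0|A0].
  have := (ae_eq_integral_abs m1 measurableT mf).1; rewrite abs => /(_ A0).
  by apply: filterS => x /(_ I).
rewrite -abs; apply/(ae_eq_integral_abs m1 measurableT mf).
by apply: filterS A0 => x.
Qed.

Lemma product_null_y A : measurable A ->
  (m1 \x m2)%E A = 0%E <-> {ae m2, forall y, m1 (ysection A y) = 0%E}.
Proof.
move=> mA; have mf := measurable_fun_ysection m1 mA.
have abs : (\int[m2]_x `|(m1 \o ysection A) x|)%E = (m1 \x m2)%E A.
  by rewrite product_measure_swap//; apply: eq_integral => x _; rewrite gee0_abs.
split=> [A0|A0].
  have := (ae_eq_integral_abs m2 measurableT mf).1; rewrite abs => /(_ A0).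
  by apply: filterS => x /(_ I).
rewrite -abs; apply/(ae_eq_integral_abs m2 measurableT mf).
by apply: filterS A0 => x.
Qed.

Lemma ae_xsection (Q : T1 * T2 -> Prop) :
  {ae (m1 \x m2)%E, forall p, Q p} ->
  {ae m1, forall x, {ae m2, forall y, Q (x, y)}}.
Proof.
move=> [A [mA /(product_null_x mA) A0 QA]].
apply: filterS A0 => x Ax0; exists (xsection A x); split => //.
  exact: measurable_xsection.
by move=> y /= nQ; rewrite /xsection /= inE; exact: QA.
Qed.

Lemma ae_prod_x (Q : T1 * T2 -> Prop) : measurable [set p | ~ Q p] ->
  {ae m1, forall x, {ae m2, forall y, Q (x, y)}} ->
  {ae (m1 \x m2)%E, forall p, Q p}.
Proof.
move=> mQ aeQ; exists [set p | ~ Q p]; split => //.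
apply/product_null_x => //; apply: filterS aeQ => x [B [mB B0 QB]].
apply: (subset_measure0 _ mB _ B0) => //; first exact: measurable_xsection.
by move=> y; rewrite /xsection /= inE => /QB.
Qed.

Lemma ae_prod_y (Q : T1 * T2 -> Prop) : measurable [set p | ~ Q p] ->
  {ae m2, forall y, {ae m1, forall x, Q (x, y)}} ->
  {ae (m1 \x m2)%E, forall p, Q p}.
Proof.
move=> mQ aeQ; exists [set p | ~ Q p]; split => //.
apply/product_null_y => //; apply: filterS aeQ => x [B [mB B0 QB]].
apply: (subset_measure0 _ mB _ B0) => //; first exact: measurable_ysection.
by move=> y; rewrite /ysection /= inE => /QB.
Qed.

Lemma ae_fst (P : T1 -> Prop) : {ae m1, forall x, P x} ->
  {ae (m1 \x m2)%E, forall p, P p.1}.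
Proof.
move=> [A [mA A0 PA]]; exists (A `*` setT); split.
- exact: measurableX.
- transitivity (m1 A * m2 setT)%E; first exact: product_measure1E.
  by move: A0 => /= ->; rewrite mul0e.
- by move=> p /= nP; split => //; exact: PA.
Qed.

Lemma ae_snd (P : T2 -> Prop) : {ae m2, forall x, P x} ->
  {ae (m1 \x m2)%E, forall p, P p.2}.
Proof.
move=> [A [mA A0 PA]]; exists (setT `*` A); split.
- exact: measurableX.
- transitivity (m1 setT * m2 A)%E; first exact: product_measure1E.
  by move: A0 => /= ->; rewrite mule0.
- by move=> p /= nP; split => //; exact: PA.
Qed.

End ae_product.

Section Rfubini.
Context d1 d2 (T1 : measurableType d1) (T2 : measurableType d2) (R : realType).
Variable m1 : {sigma_finite_measure set T1 -> \bar R}.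
Variable m2 : {sigma_finite_measure set T2 -> \bar R}.

(** The integrand may have sections of infinite integral: the statement is
about the extended-valued integral, split into its two parts. *)
Lemma measurable_integral_snd (f : T1 * T2 -> R) : measurable_fun setT f ->
  measurable_fun setT (fun x => \int[m2]_y (f (x, y))%:E)%E.
Proof.
move=> mf; have mf' : measurable_fun setT (EFin \o f) by exact/measurable_EFinP.
rewrite (_ : (fun x => _) = (fun x => (\int[m2]_y (EFin \o f)^\+ (x, y) -
    \int[m2]_y (EFin \o f)^\- (x, y))%E)); last first.
  apply/funext => x; rewrite [LHS]integralE.
  by congr (_ - _)%E; apply: eq_integral => y _; rewrite ?funeposE ?funenegE.
apply: emeasurable_funB.
  apply: (measurable_fun_fubini_tonelli_F (EFin \o f)^\+%E) => //.
  exact: measurable_funepos.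
apply: (measurable_fun_fubini_tonelli_F (EFin \o f)^\-%E) => //.
exact: measurable_funeneg.
Qed.

Lemma measurable_integral_fst (f : T1 * T2 -> R) : measurable_fun setT f ->
  measurable_fun setT (fun y => \int[m1]_x (f (x, y))%:E)%E.
Proof.
move=> mf; have mf' : measurable_fun setT (EFin \o f) by exact/measurable_EFinP.
rewrite (_ : (fun x => _) = (fun y => (\int[m1]_x (EFin \o f)^\+ (x, y) -
    \int[m1]_x (EFin \o f)^\- (x, y))%E)); last first.
  apply/funext => x; rewrite [LHS]integralE.
  by congr (_ - _)%E; apply: eq_integral => y _; rewrite ?funeposE ?funenegE.
apply: emeasurable_funB.
  apply: (measurable_fun_fubini_tonelli_G (EFin \o f)^\+%E) => //.
  exact: measurable_funepos.
apply: (measurable_fun_fubini_tonelli_G (EFin \o f)^\-%E) => //.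
exact: measurable_funeneg.
Qed.

Lemma measurable_fineT (d : measure_display) (T : measurableType d) (f : T -> \bar R) :
  measurable_fun setT f -> measurable_fun setT (fun x => fine (f x)).
Proof. by move=> mf; exact: (measurableT_comp (fine_measurable measurableT)). Qed.

Lemma ae_eq_Rintegral (d : measure_display) (T : measurableType d)
    (mu : {measure set T -> \bar R}) (f g : T -> R) :
  measurable_fun setT f -> measurable_fun setT g ->
  {ae mu, forall x, f x = g x} -> \int[mu]_x f x = \int[mu]_x g x.
Proof.
move=> mf mg fg; congr fine; apply: ae_eq_integral => //.
- exact/measurable_EFinP.
- exact/measurable_EFinP.
- by apply: filterS fg => x -> _.
Qed.

Lemma Rfubini_fst (f : T1 * T2 -> R) :
  (m1 \x m2)%E.-integrable setT (EFin \o f) ->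
  \int[(m1 \x m2)%E]_p f p = \int[m1]_x \int[m2]_y f (x, y).
Proof.
move=> If; have mf : measurable_fun setT f.
  by apply/measurable_EFinP; exact: (measurable_int _ If).
rewrite [LHS]/Rintegral -(integral12_prod_meas1 If); congr fine.
apply: ae_eq_integral => //.
- exact: measurable_integral_snd.
- by apply/measurable_EFinP/measurable_fineT; exact: measurable_integral_snd.
- apply: filterS (ae_integrable1 If) => x Ix _.
  by rewrite /fubini_F/= fineK//; exact: integrable_fin_num.
Qed.

Lemma Rfubini_snd (f : T1 * T2 -> R) :
  (m1 \x m2)%E.-integrable setT (EFin \o f) ->
  \int[(m1 \x m2)%E]_p f p = \int[m2]_y \int[m1]_x f (x, y).
Proof.
move=> If; have mf : measurable_fun setT f.
  by apply/measurable_EFinP; exact: (measurable_int _ If).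
rewrite [LHS]/Rintegral -(integral21_prod_meas1 If); congr fine.
apply: ae_eq_integral => //.
- exact: measurable_integral_fst.
- by apply/measurable_EFinP/measurable_fineT; exact: measurable_integral_fst.
- apply: filterS (ae_integrable2 If) => x Ix _.
  by rewrite /fubini_G/= fineK//; exact: integrable_fin_num.
Qed.

Lemma sqint_tensor (f : T1 -> R) (g : T2 -> R) : sqint m1 f -> sqint m2 g ->
  sqint (m1 \x m2)%E (fun p => f p.1 * g p.2).
Proof.
move=> [mf fi] [mg gi].
have mF : measurable_fun setT (fun p : T1 * T2 => f p.1 * g p.2).
  by apply: measurable_funM; exact: measurableT_comp.
have mf2 : measurable_fun setT (fun x => (f x ^+ 2)%:E).
  by apply/measurable_EFinP; exact: measurable_funX.
have mg2 : measurable_fun setT (fun x => (g x ^+ 2)%:E).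
  by apply/measurable_EFinP; exact: measurable_funX.
split => //; rewrite fubini_tonelli1//=; last 2 first.
- by apply/measurable_EFinP; exact: measurable_funX.
- by move=> p; rewrite lee_fin sqr_ge0.
rewrite /fubini_F/=.
under eq_integral => x _ do
  [under eq_integral => y _ do rewrite exprMn EFinM;
   rewrite ge0_integralZl//; [|by move=> y _; rewrite lee_fin sqr_ge0|by rewrite lee_fin sqr_ge0]].
rewrite ge0_integralZr//.
- by rewrite lte_mul_pinfty//; [by apply: integral_ge0 => x _; rewrite lee_fin sqr_ge0|
    rewrite ge0_fin_numE//; apply: integral_ge0 => x _; rewrite lee_fin sqr_ge0].
- by move=> x _; rewrite lee_fin sqr_ge0.
- by apply: integral_ge0 => x _; rewrite lee_fin sqr_ge0.
Qed.

Lemma sqint_ae_section (g : T1 * T2 -> R) : sqint (m1 \x m2)%E g ->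
  {ae m1, forall x, sqint m2 (fun y => g (x, y))}.
Proof.
move=> sg; have [mg _] := sg; have Ig := sqint_integrable_sqr sg.
apply: filterS (ae_integrable1 Ig) => x Ix; split.
  exact: measurableT_comp mg (measurable_pair1 _).
exact: integrable_lty Ix.
Qed.

End Rfubini.

(** * Positivity of the constant of the fractional Laplacian *)

Section gamma.
Variable R : realType.
Local Notation L1 := (@lebesgue_measure R).

(** The integral of [t^(a-1)] over [[1/n, 1]] is [(1 - n^-a) / a] by the
fundamental theorem of calculus; monotone convergence lets [n] go to infinity.
*)
Lemma integral_powR_01 (a : R) : 0 < a ->
  (\int[L1]_(t in `]0%R, 1%R]) (t `^ (a - 1))%:E <= (a^-1)%:E)%E.
Proof.
move=> a0.
pose F (n : nat) := `[n.+1%:R^-1, 1%R]%classic : set R.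
have FE : `]0%R, 1%R]%classic = \bigcup_n F n.
  apply/seteqP; split=> [x /=|x [n _]]; rewrite /F /= !in_itv/=.
    move=> /andP[x0 x1]; exists (Num.truncn x^-1) => //.
    rewrite /F /= in_itv/= x1 andbT -[leRHS]invrK lef_pV2 ?posrE ?invr_gt0//.
    exact/ltW/truncnS_gt.
  by move=> /andP[nx ->]; rewrite andbT (lt_le_trans _ nx)// invr_gt0.
have mp (D : set R) : measurable_fun D (fun t : R => (t `^ (a - 1))%:E).
  by apply/measurable_EFinP; apply: measurable_funTS; exact: measurable_powR.
have := @ge0_nondecreasing_set_cvg_integral _ (measurableTypeR R) R F
  (fun t => (t `^ (a - 1))%:E) L1.
rewrite -FE => /(_ _ _ _ _)/cvg_lim <- //.
apply: lime_le; last first.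
- near=> n.
  have n1 : n.+1%:R^-1 < 1 :> R.
    rewrite invf_lt1// ltr1n ltnS.
    by near: n; exact: nbhs_infty_gt.
  have n0 : 0 < n.+1%:R^-1 :> R by rewrite invr_gt0.
  have pos (t : R) : n.+1%:R^-1 <= t -> 0 < t by exact: lt_le_trans.
  have dF (t : R) : 0 < t ->
      is_derive t 1 (fun t => a^-1 * t `^ a) (t `^ (a - 1)).
    move=> t0.
    have := @is_deriveZ R R^o R^o (fun t => t `^ a) a^-1 t 1 _ (is_derive1_powR a t0).
    by rewrite /GRing.scale/= mulrA mulVf ?mul1r// gt_eqF.
  rewrite /F (@continuous_FTC2 _ _ (fun t => a^-1 * t `^ a))//.
  + rewrite powR1 mulr1 -EFinB lee_fin lerBlDr lerDl mulr_ge0 ?powR_ge0//.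
    by rewrite invr_ge0 ltW.
  + apply: derivable_within_continuous => t; rewrite in_itv/= => /andP[t1 _].
    by apply: derivable_powR; rewrite in_itv/= andbT; exact: pos.
  + have : {within `[n.+1%:R^-1, 1%R], continuous (fun t : R => a^-1 * t `^ a)}.
      apply: derivable_within_continuous => t; rewrite in_itv/= => /andP[t1 _].
      by apply: ex_derive; exact: dF (pos _ t1).
    move=> /(continuous_within_itvP _ n1)[_ cl cr]; split => //.
    move=> t; rewrite in_itv/= => /andP[t1 _].
    by apply: ex_derive; exact: dF (pos _ (ltW t1)).
  + move=> t; rewrite in_itv/= => /andP[t1 _].
    by rewrite derive1E; apply: derive_val; exact: dF (pos _ (ltW t1)).
- apply: ereal_nondecreasing_is_cvgn.
  apply: ge0_nondecreasing_set_nondecreasing_integral => //.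
  + apply/nondecreasing_seqP => n; rewrite subsetEset => x.
    rewrite /F /= !in_itv/= => /andP[nx ->]; rewrite andbT (le_trans _ nx)//.
    by rewrite lef_pV2 ?posrE// ler_nat.
  + by move=> n; exact: measurable_itv.
  + by move=> n; exact: mp.
  + by move=> n x _; rewrite lee_fin powR_ge0.
- apply/nondecreasing_seqP => n; rewrite subsetEset => x.
  rewrite /F /= !in_itv/= => /andP[nx ->]; rewrite andbT (le_trans _ nx)//.
  by rewrite lef_pV2 ?posrE// ler_nat.
- by move=> n; exact: measurable_itv.
- by move=> n; exact: mp.
- by move=> n x _; rewrite lee_fin powR_ge0.
Unshelve. all: by end_near. Qed.

(** Writing [exp (-t) = exp (-t/2)^2], one factor absorbs the power of [t] by
the power series of the exponential, and the other one is twice the density of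
the exponential law of parameter [1/2], whose integral is known. *)
Lemma gamma_tail (z : R) : exists2 C : R, 0 <= C &
  forall t, 1 <= t -> t `^ (z - 1) * expR (- t) <= C * exponential_pdf 2^-1 t.
Proof.
pose n := Num.truncn z.
exists (2 * (2 ^+ n.+1 * (n.+1)`!%:R)) => [|t t1].
  by rewrite !mulr_ge0// exprn_ge0.
have t0 : 0 <= t by lra.
rewrite exponential_pdfE//.
have -> : expR (- t) = expR (- 2^-1 * t) * expR (- 2^-1 * t).
  by rewrite -expRD; congr expR; lra.
rewrite mulrA [leRHS]mulrA ler_wpM2r ?expR_ge0//.
rewrite mulNr expRN ler_pdivrMr ?expR_gt0//.
have h : t `^ (z - 1) <= t ^+ n.+1.
  rewrite -powR_mulrn// ler_powR//.
  by have := truncnS_gt z; rewrite -/n; lra.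
apply: le_trans h _.
have := @expR_ge1Dxn R (2^-1 * t) n; rewrite mulr_ge0// => /(_ isT).
rewrite exprMn => h.
have f0 : (0 : R) < (n.+1)`!%:R by rewrite ltr0n fact_gt0.
have p0 : (0 : R) < 2 ^+ n.+1 by rewrite exprn_gt0.
have {}h : 2^-1 ^+ n.+1 * t ^+ n.+1 / (n.+1)`!%:R <= expR (2^-1 * t) by lra.
move: h; rewrite ler_pdivrMr// exprVn mulrC ler_pdivrMr// => h.
by apply: le_trans h _; rewrite le_eqVlt; apply/orP; left; apply/eqP; field.
Qed.

(** The integral of a positive function over a set of positive measure is
positive as soon as it is finite; finiteness is [integral_powR_01] near [0] and
[gamma_tail] near infinity. *)
Lemma Gamma_gt0 (z : R) : 0 < z -> 0 < Gamma z.
Proof.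
move=> z0; rewrite /Gamma /Rintegral.
set f := fun t : R => t `^ (z - 1) * expR (- t).
have mf (D : set R) : measurable_fun D (EFin \o f).
  apply/measurable_EFinP; apply: measurable_funTS; apply: measurable_funM.
    exact: measurable_powR.
  by apply: measurableT_comp => //; exact: measurable_expR.
have f0 t : (0 <= (f t)%:E)%E by rewrite lee_fin mulr_ge0 ?powR_ge0 ?expR_ge0.
apply: fine_gt0; apply/andP; split.
  rewrite lt0e; apply/andP; split; last by apply: integral_ge0 => t _; exact: f0.
  apply/negP => /eqP f_0.
  have : (\int[L1]_(t in `]0%R, +oo[) `|(f t)%:E| = 0)%E.
    by rewrite -f_0; apply: eq_integral => t _; rewrite gee0_abs.
  move=> /(ae_eq_integral_abs L1 (measurable_itv _) (mf _)).
  move=> [A [mA A0 sA]].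
  have sub : `]0%R, +oo[%classic `<=` A.
    move=> t t0; apply: sA => /= /(_ t0) /eqP.
    move: t0; rewrite /= in_itv/= andbT => t0.
    by rewrite eqe mulf_eq0 !gt_eqF ?powR_gt0 ?expR_gt0.
  have : L1 `]0%R, +oo[%classic = 0%E.
    exact: (@subset_measure0 _ _ _ L1 _ _ (measurable_itv _) mA sub A0).
  by rewrite lebesgue_measure_itv/= ltry.
have [C C0 hC] := gamma_tail z.
pose g (t : R) := ((t `^ (z - 1))%:E : \bar R).
have mg (D : set R) : measurable_fun D g.
  by apply/measurable_EFinP; apply: measurable_funTS; exact: measurable_powR.
rewrite (@itv_bndbnd_setU _ _ _ (BRight 1%R)) ?bnd_simp//.
rewrite ge0_integral_setU; [|exact: measurable_itv|exact: measurable_itv|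
    exact: mf|by move=> t _; exact: f0|]; last first.
  by apply/disj_setPS => t [/=]; rewrite !in_itv/= andbT; lra.
apply: lte_add_pinfty.
  apply: le_lt_trans (ltry z^-1); apply: le_trans (integral_powR_01 z0).
  apply: ge0_le_integral; [exact: measurable_itv|by move=> t _; exact: f0|
    exact: mf|exact: mg|].
  move=> t; rewrite /= in_itv/= => /andP[t0 _].
  by rewrite lee_fin ler_piMr ?powR_ge0// expR_le1 oppr_le0 ltW.
apply: (@le_lt_trans _ _
    (\int[L1]_x (C%:E * (exponential_pdf 2^-1 x)%:E))%E); last first.
  rewrite ge0_integralZl//.
  - by rewrite integral_exponential_pdf// mule1 ltry.
  - by apply/measurable_EFinP; exact: measurable_exponential_pdf.
  - by move=> t _; rewrite lee_fin exponential_pdf_ge0.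
rewrite integral_mkcond; apply: ge0_le_integral => //.
- by move=> t _; rewrite patchE; case: ifP => // _; exact: f0.
- by apply/(measurable_restrictT _ _).1; [exact: measurable_itv|exact: mf].
- by apply: measurable_funeM; apply/measurable_EFinP; exact: measurable_exponential_pdf.
- move=> t _; rewrite patchE; case: ifPn => [|_].
    by rewrite inE/= in_itv/= andbT -EFinM lee_fin => /ltW; exact: hC.
  by rewrite -EFinM lee_fin mulr_ge0// exponential_pdf_ge0.
Qed.

(** Without it the seminorm [F (u, u)^(1/2)] would not control [u]. *)
Lemma C_Ns_gt0 (N : nat) (s : R) : 0 < s < 1 -> 0 < C_Ns N s.
Proof.
move=> /andP[s0 s1]; rewrite /C_Ns.
have N0 : (0 : R) <= N%:R by [].
by rewrite divr_gt0 ?mulr_gt0 ?powR_gt0 ?pi_gt0 ?Gamma_gt0//; lra.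
Qed.

End gamma.

(** * Gagliardo quotients and the fractional Poincare inequality *)

Section rV_measurable.
Context (R : realType).

Lemma measurable_coord n (i : 'I_n) :
  measurable_fun [set: 'rV[R]_n] (fun x => x ord0 i).
Proof.
move=> _ Y mY; rewrite setTI; apply: sub_sigma_algebra => /=.
rewrite -bigcup_seq/=; exists i => /=; first by rewrite mem_index_enum.
by exists Y => //; rewrite setTI.
Qed.

(** The topology is that of the sup norm and the sigma-algebra is generated by
the coordinates: an open set is the countable union of the cubes with rational
centre and radius [1/k] that it contains. *)
Lemma open_rV_measurable n (U : set 'rV[R]_n) : open U -> measurable U.
Proof.
move=> oU.
pose B (qk : 'rV[rat]_n * nat) : set 'rV[R]_n :=
  [set x | forall i, `|ratr (qk.1 ord0 i) - x ord0 i| < qk.2.+1%:R^-1].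
pose D := [set qk | B qk `<=` U].
have -> : U = \bigcup_qk (if pselect (D qk) then B qk else set0).
  apply/seteqP; split=> [x Ux|x [qk _]]; last by case: pselect => // Dqk; exact: Dqk.
  have : U° x by move: oU; rewrite openE; exact.
  move=> /nbhs_ballP[e /= e0 xeU].
  pose k := Num.truncn (2 / e).
  have ke : k.+1%:R^-1 < e / 2.
    rewrite -[ltRHS]invrK ltf_pV2 ?posrE ?invr_gt0 ?divr_gt0//.
    by rewrite invf_div; exact: truncnS_gt.
  have k0 : (0 : R) < k.+1%:R^-1 by rewrite invr_gt0.
  have /choice[q qP] : forall i : 'I_n, exists q : rat,
      `|ratr q - x ord0 i| < k.+1%:R^-1.
    move=> i; have /rat_in_itvoo[q /itvP qi] : x ord0 i < x ord0 i + k.+1%:R^-1.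
      by rewrite ltrDl.
    by exists q; rewrite ger0_norm ?subr_ge0 ?qi// ltrBlDl qi.
  pose qk := (\row_i q i, k).
  have Bx : B qk x by move=> i; rewrite mxE; exact: qP.
  exists qk => //; case: pselect => //= -[] y By; apply: xeU.
  split=> // j i; have -> : j = ord0 by exact: ord1.
  rewrite /ball/=; apply: le_lt_trans (ler_distD (ratr (q i)) _ _) _.
  have := Bx i; have := By i; rewrite /= mxE (distrC (x _ _)) => h1 h2.
  apply: lt_trans (ltrD h2 h1) _; rewrite [ltRHS]splitr; exact: (ltrD ke ke).
apply: countable_bigcupT_measurable => [|qk]; first exact: countableP.
case: pselect => [? |? ] /=; last exact: measurable0.
have -> : B qk = \bigcap_(i in [set: 'I_n])
    ((fun x : 'rV[R]_n => x ord0 i) @^-1` (ball (ratr (qk.1 ord0 i) : R) qk.2.+1%:R^-1)).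
  by apply/seteqP; split=> [x h i _|x h i]; [exact: h|exact: (h i)].
apply: fin_bigcap_measurable => // i _.
by rewrite -[X in measurable X]setTI; apply: measurable_coord => //; exact: measurable_ball.
Qed.

Lemma measurable_enorm_sub n :
  measurable_fun [set: 'rV[R]_n * 'rV[R]_n] (fun z => enorm (z.1 - z.2)).
Proof.
rewrite /enorm; apply: (@measurableT_comp _ _ _ _ _ _ (@Num.sqrt R)).
  by apply: continuous_measurable_fun; exact: sqrt_continuous.
apply: measurable_sum => i; apply: measurable_funX.
under eq_fun do rewrite mxE mxE.
by apply: measurable_funB; [exact: measurableT_comp (measurable_coord i) measurable_fst|
  exact: measurableT_comp (measurable_coord i) measurable_snd].
Qed.

Lemma enorm_gt0 n (x : 'rV[R]_n) i : x ord0 i != 0 -> 0 < enorm x.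
Proof.
move=> xi; rewrite sqrtr_gt0 (bigD1 i)//= ltr_pwDl ?sqrr_gte0//.
  by rewrite exprn_even_gt0.
by apply: sumr_ge0 => j _; exact: sqr_ge0.
Qed.

Lemma enorm_le n (x : 'rV[R]_n) M : 0 <= M -> (forall i, `|x ord0 i| <= M) ->
  enorm x <= Num.sqrt (n%:R * M ^+ 2).
Proof.
move=> M0 xM; rewrite ler_sqrt ?mulr_ge0 ?sqr_ge0//.
apply: (@le_trans _ _ (\sum_(i < n) M ^+ 2)); last first.
  by rewrite sumr_const card_ord mulr_natl.
by apply: ler_sum => i _; rewrite -real_normK ?num_real// ler_pXn2r ?nnegrE.
Qed.

Definition box (n : nat) (a b : R) : set 'rV[R]_n :=
  [set x | forall i, a <= x ord0 i <= b].

Arguments box n a b : clear implicits.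

Lemma measurable_box n a b : measurable (box n a b).
Proof.
have -> : box n a b = \bigcap_(i in [set: 'I_n])
    ((fun x : 'rV[R]_n => x ord0 i) @^-1` `[a, b]).
  by apply/seteqP; split=> [x h i _|x h i] /=; have := h i;
    rewrite /= in_itv/=; exact.
apply: fin_bigcap_measurable => // i _.
by rewrite -[X in measurable X]setTI; apply: measurable_coord => //; exact: measurable_itv.
Qed.

Lemma cons_rV0 n (x : R) (v : 'rV[R]_n) :
  (row_mx (x%:M : 'rV[R]_1) v : 'rV[R]_n.+1) ord0 ord0 = x.
Proof.
transitivity (row_mx (x%:M : 'rV[R]_1) v ord0 (lshift n ord0)).
  by congr (_ _ _); exact/val_inj.
by rewrite row_mxEl mxE eqxx mulr1n.
Qed.

Lemma cons_rVS n (x : R) (v : 'rV[R]_n) j :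
  (row_mx (x%:M : 'rV[R]_1) v : 'rV[R]_n.+1) ord0 (lift ord0 j) = v ord0 j.
Proof.
transitivity (row_mx (x%:M : 'rV[R]_1) v ord0 (rshift 1 j)).
  by congr (_ _ _); exact/val_inj.
by rewrite row_mxEr.
Qed.

(** Induction on the dimension, following the slicing by the first coordinate
that defines the measure. *)
Lemma lebesgue_box n (a b : R) : a <= b ->
  lebesgue_rV (box n a b) = ((b - a) ^+ n)%:E.
Proof.
move=> ab; elim: n => [|n IH].
  by rewrite /= expr0 indicE mem_set// => -[].
transitivity (\int[lebesgue_measure]_(x in `[a, b]) (cst ((b - a) ^+ n)%:E x))%E.
  rewrite [RHS]integral_mkcond; apply: eq_integral => x _.
  rewrite patchE; case: ifPn => [|]; rewrite ?notin_setE ?inE/= in_itv/= => xab.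
    rewrite -IH; congr (lebesgue_rV _); apply/seteqP; split=> v h i.
      by have := h (lift ord0 i); rewrite cons_rVS.
    by case: (unliftP ord0 i) => [j ->|->]; rewrite ?cons_rVS ?cons_rV0//; exact: h.
  rewrite (_ : [set v | _] = set0); first exact: (measure0 (@lebesgue_rV R n)).
  apply/seteqP; split=> // v h; apply: xab.
  by have := h ord0; rewrite cons_rV0.
rewrite integral_cst//= lebesgue_measure_itv/=.
move: ab; rewrite le_eqVlt => /predU1P[->|ab].
  by rewrite ltxx mule0 subrr exprS mul0r.
by rewrite lte_fin ab -EFinB -EFinM exprS mulrC.
Qed.

End rV_measurable.

Section poincare.
Context (R : realType) (N : nat) (s : R).
Local Notation leb := (@lebesgue_rV R N).

Definition gkernel (z : 'rV[R]_N * 'rV[R]_N) : R :=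
  (enorm (z.1 - z.2) `^ (N%:R + 2 * s))^-1.

Lemma gkernel_ge0 z : 0 <= gkernel z.
Proof. by rewrite invr_ge0 powR_ge0. Qed.

Lemma measurable_gkernel : measurable_fun setT gkernel.
Proof.
rewrite (_ : gkernel = fun z => enorm (z.1 - z.2) `^ (- (N%:R + 2 * s))).
  apply: (@measurableT_comp _ _ _ _ _ _ (@powR R ^~ _) _
    (fun z : 'rV[R]_N * 'rV[R]_N => enorm (z.1 - z.2))).
    exact: measurable_powR.
  exact: measurable_enorm_sub.
by apply/funext => z; rewrite /gkernel -powRN.
Qed.

(** The difference quotient [(u x - u y) / |x - y|^(N/2 + s)]: the bilinear form
[F] is the [L^2] scalar product of these quotients, which reduces the theory of
[H^s] to that of square-integrable functions. *)
Definition diffq (u : 'rV[R]_N -> R) (z : 'rV[R]_N * 'rV[R]_N) : R :=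
  (u z.1 - u z.2) * Num.sqrt (gkernel z).

Lemma kernel_formE u v z : kernel_form s u v z = diffq u z * diffq v z.
Proof.
rewrite /kernel_form /diffq mulrACA -expr2 sqr_sqrtr ?gkernel_ge0//.
Qed.

Lemma measurable_sqrt_gkernel : measurable_fun setT (fun z => Num.sqrt (gkernel z)).
Proof.
apply: (@measurableT_comp _ _ _ _ _ _ (@Num.sqrt R)) measurable_gkernel.
by apply: continuous_measurable_fun; exact: sqrt_continuous.
Qed.

Lemma measurable_diffq u : measurable_fun setT u -> measurable_fun setT (diffq u).
Proof.
move=> mu; apply: measurable_funM measurable_sqrt_gkernel.
by apply: measurable_funB; exact: measurableT_comp.
Qed.

(** Since [Omega] is bounded, some unit cube [D] stays at positive and bounded
distance from [Omega], and [u = 0] on [D].  For [x] in [Omega] and [y] in [D]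
the quotient [(u x - u y)^2 / |x - y|^(N+2s)] is then at least
[u x ^ 2 / L^(N+2s)]; integrate over [Omega * D]. *)
Lemma poincare (Omega : set 'rV[R]_N) : (1 <= N)%N -> 0 < s ->
  bounded_set Omega -> exists2 C : R, 0 < C &
  forall u : 'rV[R]_N -> R, measurable_fun setT u ->
    {ae leb, forall x, ~ Omega x -> u x = 0} ->
    (\int[leb]_x (u x ^+ 2)%:E <=
      C%:E * \int[(leb \x leb)%E]_z (diffq u z ^+ 2)%:E)%E.
Proof.
move=> N1 s0 [M0 [_ OM0]].
pose M := Num.max 0 (M0 + 1).
have M_ge0 : 0 <= M by rewrite le_max lexx.
have OM x i : Omega x -> `|x ord0 i| <= M.
  move=> Ox; have := OM0 (M0 + 1) _ x Ox; rewrite ltrDl ltr01 => /(_ isT) xM.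
  apply: (@le_trans _ _ `|x|); last by rewrite (le_trans xM)// le_max lexx orbT.
  rewrite [leRHS]/Num.norm /= mx_normrE.
  by apply/bigmax_geP; right => /=; exists (ord0, i).
(* [Omega] lies in [[-M, M]^N] and [D] below in [[M+1, M+2]^N]: the distance
   between two of their points is at most [L]. *)
pose L : R := Num.sqrt (N%:R * (2 * M + 2) ^+ 2).
pose p := N%:R + 2 * s.
have p0 : 0 < p by rewrite /p ltr_wpDl// mulr_gt0.
pose D := @box R N (M + 1) (M + 2).
have L0 : 0 < L by rewrite sqrtr_gt0 mulr_gt0 ?exprn_gt0 ?ltr0n//; lra.
have mD : measurable D by exact: measurable_box.
have lebD : leb D = 1%E.
  by rewrite lebesgue_box; [congr EFin; rewrite (_ : _ - _ = 1) ?expr1n//|]; lra.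
exists (L `^ p); first exact: powR_gt0.
move=> u mu u0.
have mu2 : measurable_fun setT (fun x => (u x ^+ 2)%:E).
  by apply/measurable_EFinP; exact: measurable_funX.
have mh : measurable_fun setT (fun z : 'rV[R]_N * 'rV[R]_N =>
    (u z.1 ^+ 2)%:E * (\1_D z.2)%:E)%E.
  apply: emeasurable_funM; first exact: (measurableT_comp mu2 measurable_fst).
  apply/measurable_EFinP; apply: (measurableT_comp _ measurable_snd).
  exact: measurable_indic.
have mq : measurable_fun setT (fun z => (diffq u z ^+ 2)%:E).
  by apply/measurable_EFinP; apply: measurable_funX; exact: measurable_diffq.
have -> : (\int[leb]_x (u x ^+ 2)%:E = \int[(leb \x leb)%E]_z
    ((u z.1 ^+ 2)%:E * (\1_D z.2)%:E))%E.
  rewrite fubini_tonelli1//; last first.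
    by move=> z; rewrite -EFinM lee_fin mulr_ge0// sqr_ge0.
  apply: eq_integral => x _; rewrite /fubini_F/= ge0_integralZl//.
  - transitivity ((u x ^+ 2)%:E * leb D)%E; first by rewrite lebD mule1.
    by rewrite integral_indic// setIT.
  - by apply/measurable_EFinP; exact: measurable_indic.
  - by rewrite lee_fin sqr_ge0.
rewrite -ge0_integralZl//; last 2 first.
- by move=> z _; rewrite lee_fin sqr_ge0.
- by rewrite lee_fin powR_ge0.
apply: ae_ge0_le_integral => //.
- by move=> z _; rewrite -EFinM lee_fin mulr_ge0// sqr_ge0.
- by move=> z _; rewrite -EFinM lee_fin mulr_ge0// ?sqr_ge0// powR_ge0.
- exact: measurable_funeM.
have := ae_fst leb u0; have := ae_snd leb u0; apply: filterS2 => z u2 u1 _.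
rewrite -!EFinM lee_fin.
have rhs0 : 0 <= L `^ p * diffq u z ^+ 2 by rewrite mulr_ge0 ?sqr_ge0 ?powR_ge0.
have [Oz1|Oz1] := pselect (Omega z.1); last by rewrite (u1 Oz1) expr2 !mul0r.
rewrite indicE; have [|] := boolP (z.2 \in D); last by rewrite mulr0.
rewrite inE => Dz2; rewrite mulr1.
have Oz2 : ~ Omega z.2.
  move=> Oz; have := OM _ (Ordinal N1) Oz; have /= := Dz2 (Ordinal N1).
  by rewrite ler_norml; lra.
rewrite /diffq (u2 Oz2) subr0 exprMn sqr_sqrtr ?gkernel_ge0//.
rewrite mulrC -mulrA ler_peMr ?sqr_ge0// /gkernel -/p.
have e0 : 0 < enorm (z.1 - z.2).
  apply: (@enorm_gt0 _ _ _ (Ordinal N1)); rewrite !mxE.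
  have := OM _ (Ordinal N1) Oz1; have /= := Dz2 (Ordinal N1).
  by rewrite ler_norml; lra.
have eL : enorm (z.1 - z.2) <= L.
  apply: enorm_le => [|i]; first lra.
  rewrite !mxE; have := OM _ i Oz1; have /= := Dz2 i.
  by rewrite !ler_norml; lra.
rewrite mulrC ler_pdivlMr ?powR_gt0// mul1r.
by apply: ge0_ler_powR => //; rewrite ?nnegrE ?ltW.
Qed.

End poincare.

(** * The space of the solutions and the pivot pairing *)

Section Hs0_theory.
Context (R : realType) (N : nat) (Omega : set 'rV[R]_N) (s : R).
Hypothesis s01 : 0 < s < 1.
Local Notation leb := (@lebesgue_rV R N).
Local Notation dq := (@diffq R N s).

Lemma HsP u : Hs s u <-> sqint leb u /\ sqint (leb \x leb)%E (dq u).
Proof.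
have E : (\int[(leb \x leb)%E]_z (kernel_form s u u z)%:E =
    \int[(leb \x leb)%E]_z (dq u z ^+ 2)%:E)%E.
  by apply: eq_integral => z _; rewrite kernel_formE expr2.
rewrite /Hs /= E; split=> [[/Lfun2P su du]|[su [_ du]]].
  by split => //; split => //; apply: measurable_diffq; case: su.
by split => //; apply/Lfun2P.
Qed.

Lemma FformE u v : Fform s u v =
  C_Ns N s / 2 * \int[(leb \x leb)%E]_z (dq u z * dq v z).
Proof. by congr (_ * _); apply: eq_Rintegral => z _; exact: kernel_formE. Qed.

Lemma diffq_lin a u v z :
  dq (fun x => a * u x + v x) z = a * dq u z + dq v z.
Proof. by rewrite /diffq; ring. Qed.

Lemma Hs0_lin a u v : Hs0 Omega s u -> Hs0 Omega s v ->
  Hs0 Omega s (fun x => a * u x + v x).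
Proof.
move=> [/HsP[su du] u0] [/HsP[sv dv] v0]; split.
  apply/HsP; split; first exact: (sqintD (sqintZ a su) sv).
  have := sqintD (sqintZ a du) dv; congr sqint; apply/funext => z.
  by rewrite diffq_lin.
by apply: filterS2 u0 v0 => x u0 v0 Ox; rewrite u0// v0// mulr0 addr0.
Qed.

Lemma Hs0_zero : Hs0 Omega s (fun=> 0).
Proof.
split; last exact: aeW.
apply/HsP; split.
  split => //; under eq_integral do rewrite expr2 mul0r.
  by rewrite integral0.
have -> : dq (fun=> 0) = fun=> 0.
  by apply/funext => z; rewrite /diffq subrr mul0r.
split => //; under eq_integral do rewrite expr2 mul0r.
by rewrite integral0.
Qed.

Lemma Hs0_scale a u : Hs0 Omega s u -> Hs0 Omega s (fun x => a * u x).
Proof.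
move=> Hu; have := Hs0_lin a Hu Hs0_zero.
by congr Hs0; apply/funext => x; rewrite addr0.
Qed.

Lemma Fform_ge0 (u : 'rV[R]_N -> R) : 0 <= Fform s u u.
Proof.
rewrite FformE; apply: mulr_ge0.
  by rewrite divr_ge0// ltW// C_Ns_gt0.
by apply: Rintegral_ge0 => z _; rewrite -expr2 sqr_ge0.
Qed.

Lemma Hs0_norm_sqr (u : 'rV[R]_N -> R) : Hs0_norm s u ^+ 2 = Fform s u u.
Proof. by rewrite sqr_sqrtr// Fform_ge0. Qed.

Lemma Hs0_norm_scale a (u : 'rV[R]_N -> R) : Hs s u ->
  Hs0_norm s (fun x => a * u x) = `|a| * Hs0_norm s u.
Proof.
move=> /HsP[_ du]; rewrite /Hs0_norm.
have -> : Fform s (fun x => a * u x) (fun x => a * u x) = a ^+ 2 * Fform s u u.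
  rewrite !FformE mulrCA; congr (_ * _).
  rewrite -RintegralZl//; last exact: sqintM.
  by apply: eq_Rintegral => z _; rewrite /diffq; ring.
by rewrite sqrtrM ?sqr_ge0// sqrtr_sqr.
Qed.

Lemma Hs0_poincare : (1 <= N)%N -> bounded_set Omega ->
  exists2 C, 0 < C & forall u, Hs0 Omega s u ->
    \int[leb]_x (u x ^+ 2) <= C * Hs0_norm s u ^+ 2.
Proof.
move=> N1 bO; have /andP[s0 _] := s01.
have [C C0 hC] := poincare N1 s0 bO.
have c0 := C_Ns_gt0 N s01.
exists (C * (2 / C_Ns N s)); first by rewrite mulr_gt0// divr_gt0.
move=> u [/HsP[su du] u0].
have := hC u (proj1 su) u0.
have Iu := sqint_integrable_sqr su; have Id := sqint_integrable_sqr du.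
rewrite -(fineK (integrable_fin_num measurableT Iu)).
rewrite -(fineK (integrable_fin_num measurableT Id)) -EFinM lee_fin.
move/le_trans; apply; rewrite Hs0_norm_sqr FformE.
rewrite (_ : C * (2 / C_Ns N s) * _ =
    C * \int[(leb \x leb)%E]_z (dq u z * dq u z)); last first.
  by field; rewrite gt_eqF.
by apply: ler_wpM2l; [exact: ltW|rewrite le_eqVlt eqxx].
Qed.

Hypotheses (N1 : (1 <= N)%N) (oO : open Omega) (bO : bounded_set Omega).

(** The element of [H^{-s}] defined by [v] through the pivot space
[L^2(Omega)]. *)
Definition pairing (v u : 'rV[R]_N -> R) : R := \int[leb]_(x in Omega) (v x * u x).

Lemma pairingE v u : pairing v u = \int[leb]_x ((v \_ Omega) x * u x).
Proof.
rewrite /pairing Rintegral_mkcond; apply: eq_Rintegral => x _.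
by rewrite !patchE; case: ifP => //; rewrite mul0r.
Qed.

Lemma pairing_lin v a u w : sqint leb v -> sqint leb u -> sqint leb w ->
  pairing v (fun x => a * u x + w x) = a * pairing v u + pairing v w.
Proof.
move=> sv su sw.
have sv' := sqint_restrict (open_rV_measurable oO) sv.
have I1 := sqintM sv' su; have I2 := sqintM sv' sw.
rewrite !pairingE -RintegralZl// -RintegralD//.
- by apply: eq_Rintegral => x _; ring.
- by have := integrableZl measurableT a I1.
Qed.

(** Cauchy-Schwarz in [L^2], then Poincare. *)
Lemma pairing_bound v : sqint leb v -> exists2 C, 0 <= C &
  forall u, Hs0 Omega s u -> `|pairing v u| <= C * Hs0_norm s u.
Proof.
move=> sv; have [C C0 hC] := Hs0_poincare N1 bO.
have sv' := sqint_restrict (open_rV_measurable oO) sv.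
set a := \int[leb]_x ((v \_ Omega) x ^+ 2).
exists (Num.sqrt (a * C)); first exact: sqrtr_ge0.
move=> u Hu; have [/HsP[su _] _] := Hu.
have n0 : 0 <= Hs0_norm s u by exact: sqrtr_ge0.
have a0 : 0 <= a by apply: Rintegral_ge0 => x _; exact: sqr_ge0.
have -> : Num.sqrt (a * C) * Hs0_norm s u = Num.sqrt (a * C * Hs0_norm s u ^+ 2).
  by rewrite (sqrtrM _ (mulr_ge0 a0 (ltW C0))) sqrtr_sqr ger0_norm.
rewrite -sqrtr_sqr ler_sqrt; last by rewrite !mulr_ge0 ?sqr_ge0 ?(ltW C0).
rewrite pairingE; apply: le_trans (Rintegral_cauchy_schwarz sv' su) _.
by rewrite -mulrA ler_wpM2l// hC.
Qed.

Lemma pairing_dual v c : sqint leb v ->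
  Hs0_dual Omega s (fun u => c * pairing v u).
Proof.
move=> sv; split.
  move=> a u w [/HsP[su _] _] [/HsP[sw _] _].
  by rewrite pairing_lin//; ring.
have [C C0 hC] := pairing_bound sv; exists (`|c| * C) => u Hu.
by rewrite normrM -mulrA ler_wpM2l// hC.
Qed.

(** The dual norm is a supremum in the reals, whose homogeneity is only
available for functionals with a finite bound. *)
Lemma Hs0_dual_norm_pairing v c : sqint leb v ->
  Hs0_dual_norm Omega s (fun u => c * pairing v u) =
  `|c| * Hs0_dual_norm Omega s (pairing v).
Proof.
move=> sv; have [C C0 hC] := pairing_bound sv.
pose B := [set u | Hs0 Omega s u /\ Hs0_norm s u <= 1].
have B0 : B (fun=> 0).
  split; first exact: Hs0_zero.
  have := Hs0_norm_scale 0 (proj1 Hs0_zero); by rewrite normr0 !mul0r => ->.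
have ne (l : ('rV[R]_N -> R) -> R) : [set `|l u| | u in B] !=set0.
  by exists `|l (fun=> 0)|; exists (fun=> 0).
have ub c' : has_ubound [set `|c' * pairing v u| | u in B].
  exists (`|c'| * C) => _ [u [Hu u1] <-]; rewrite normrM ler_wpM2l//.
  by apply: le_trans (hC _ Hu) _; rewrite ler_piMr.
have ub1 : has_ubound [set `|pairing v u| | u in B].
  by have := ub 1; congr has_ubound; apply: eq_imagel => u _; rewrite mul1r.
rewrite /Hs0_dual_norm -/B; apply/eqP; rewrite eq_le; apply/andP; split.
  apply: ge_sup => // _ [u Bu <-]; rewrite normrM ler_wpM2l//.
  by apply: ub_le_sup => //; exists u.
have [->|c0] := eqVneq c 0.
  rewrite normr0 mul0r; apply: le_trans (ub_le_sup (ub 0) _); last first.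
    by exists (fun=> 0); [exact: B0|reflexivity].
  by [].
rewrite mulrC -ler_pdivlMr ?normr_gt0//.
apply: ge_sup => // _ [u Bu <-]; rewrite ler_pdivlMr ?normr_gt0//.
by rewrite mulrC -normrM; apply: ub_le_sup => //; exists u.
Qed.

End Hs0_theory.

(** * Test functions with separated variables *)

Section scaled_curve.
Import HBSimple.
Context (R : realType) (T : R) (V : zmodType) (X : set V) (nrm : V -> R).
Variables (sc : R -> V) (m : R).
Hypothesis Xsc : forall c, X (sc c).
Hypothesis nrm_sc : forall a b, nrm (sc a - sc b) = `|a - b| * m.
Hypothesis sc0 : sc 0 = 0.

(** A curve [h t * e] with [h] bounded and measurable is strongly measurable
because simple functions converge to [h] pointwise.  The map [sc c] stands for
[c * e]; the two instances are a function of [H^s_0] and a functional of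
[H^{-s}], for which only this much of a normed space is at hand. *)
Lemma bochner_L2_scaled (h : R -> R) (M : R) : measurable_fun setT h ->
  (forall t, `|h t| <= M) -> bochner_L2 T X nrm (sc \o h).
Proof.
move=> mh hM; split.
- by apply: aeW => t _; exact: Xsc.
- have /measurable_EFinP mh' := mh.
  have [g gh] := approximation_sfun measurableT mh'.
  exists (fun n => sc \o (g n : R -> R)) => [n|].
    split.
    + rewrite -(image_comp (g n) sc); apply: finite_image.
      exact: fimfunP.
    + by move=> t; exact: Xsc.
    + move=> v; rewrite comp_preimage.
      rewrite (_ : _ @^-1` _ = \bigcup_(r in range (g n) `&` sc @^-1` [set v])
        (g n @^-1` [set r])); last first.
        apply/seteqP; split => [t /= <-|t [r [_ /= <-] /= <-]]//.
        by exists (g n t).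
      apply: fin_bigcup_measurable; last by move=> r _; exact: measurable_sfunP.
      by apply: finite_setIl; exact: fimfunP.
  apply: aeW => t _ /=.
  under eq_fun do rewrite nrm_sc.
  rewrite -(mul0r m); apply: cvgMl.
  have := gh t I => /fine_cvgP[_ ght].
  have -> : (0 : R) = `|h t - h t| by rewrite subrr normr0.
  by apply: cvg_norm; apply: cvgB => //; exact: cvg_cst.
- have nE t : nrm (sc (h t)) = `|h t| * m by rewrite -[sc _]subr0 -sc0 nrm_sc subr0.
  apply: (@le_lt_trans _ _
     (\int[lebesgue_measure]_(t in `]0%R, T[) (cst ((M * m) ^+ 2)%:E t))%E).
    apply: ge0_le_integral => //.
    + by move=> t _; rewrite lee_fin sqr_ge0.
    + apply/measurable_EFinP; apply: measurable_funTS; apply: measurable_funX.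
      under eq_fun do rewrite /= nE.
      by apply: measurable_funM => //; exact: measurableT_comp.
    + move=> t _ /=; rewrite lee_fin nE !exprMn ler_wpM2r ?sqr_ge0//.
      by rewrite ler_pXn2r ?nnegrE// (le_trans _ (hM t)).
  rewrite integral_cst//= lebesgue_measure_itv/=; case: ifPn => _.
    by rewrite -EFinB -EFinM ltry.
  by rewrite mule0 ltry.
Qed.

End scaled_curve.

Section integration_by_parts.
Variable R : realType.
Local Notation L1 := (@lebesgue_measure R).

Lemma continuous_integrable_cc (a b : R) (f : R -> R) : continuous f ->
  L1.-integrable `[a, b] (EFin \o f).
Proof.
move=> cf; apply: continuous_compact_integrable; first exact: segment_compact.
exact: continuous_subspaceT.
Qed.

Lemma continuous_integrable_oo (a b : R) (f : R -> R) : continuous f ->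
  L1.-integrable `]a, b[ (EFin \o f).
Proof.
move=> /(@continuous_integrable_cc a b).
by apply: integrableS => //; exact: subset_itv_oo_cc.
Qed.

Lemma test_function_continuous (T : R) (theta : R -> R) : test_function T theta ->
  continuous theta /\ continuous (derive1 theta).
Proof.
move=> [dth _]; split=> t; apply/differentiable_continuous/derivable1_diffP.
  exact: (dth 0%N t).
exact: (dth 1%N t).
Qed.

(** No boundary terms: [theta] vanishes at [0] and at [T]. *)
Lemma test_function_parts (T : R) (eta eta' theta : R -> R) : 0 < T ->
  (forall t : R, is_derive t 1 eta (eta' t)) -> continuous eta' ->
  test_function T theta ->
  \int[L1]_(t in `]0, T[) (eta t * derive1 theta t) =
  - \int[L1]_(t in `]0, T[) (eta' t * theta t).
Proof.
move=> T0 deta ceta' tth; have [cth cdth] := test_function_continuous tth.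
move: tth => [dtheta [a [b [a0 bT theta0]]]].
have th0 : theta 0 = 0 by apply: theta0; rewrite negb_and -ltNge a0.
have thT : theta T = 0 by apply: theta0; rewrite negb_and -!ltNge bT orbT.
have ceta : continuous eta.
  move=> t; apply/differentiable_continuous/derivable1_diffP.
  by apply: ex_derive; exact: deta.
have wc (f : R -> R) : continuous f -> {within `[0, T], continuous f}.
  by move=> cf; apply: continuous_subspaceT.
have LR (f : R -> R) : continuous f -> (forall t, derivable f t 1) ->
    derivable_oo_LRcontinuous f 0 T.
  by move=> cf df; split=> [t _||]; [exact: df|
    apply: cvg_at_right_filter; exact: cf|apply: cvg_at_left_filter; exact: cf].
have oc (f : R -> R) : continuous f ->
    \int[L1]_(t in `]0, T[) f t = \int[L1]_(t in `[0, T]) f t.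
  move=> cf; have If := @continuous_integrable_cc 0 T _ cf.
  rewrite Rintegral_itv_bndo_bndc; last first.
    apply: (integrableS _ _ _ If) => //; exact: subset_itv_oo_cc.
  rewrite Rintegral_itv_obnd_cbnd//.
  by apply: (integrableS _ _ _ If) => //; exact: subset_itv_oc_cc.
rewrite !oc; last 2 first.
- by move=> t; apply: cvgM; [exact: ceta'|exact: cth].
- by move=> t; apply: cvgM; [exact: ceta|exact: cdth].
rewrite (@Rintegration_by_parts _ eta theta eta' (derive1 theta))//.
- by rewrite th0 thT !mulr0 subrr sub0r.
- exact: wc.
- by apply: LR; [exact: ceta|move=> t; apply: ex_derive; exact: deta].
- by move=> t _; rewrite derive1E; apply: derive_val; exact: deta.
- exact: wc.
- by apply: LR; [exact: cth|exact: (dtheta 0%N)].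
Qed.

End integration_by_parts.

Section tensor_test.
Context (R : realType) (N : nat) (Omega : set 'rV[R]_N) (s T : R).
Hypotheses (s01 : 0 < s < 1) (T0 : 0 < T) (N1 : (1 <= N)%N).
Hypotheses (oO : open Omega) (bO : bounded_set Omega).
Local Notation leb := (@lebesgue_rV R N).
Local Notation L1 := (@lebesgue_measure R).
Variables (v : 'rV[R]_N -> R) (eta eta' : R -> R) (M : R).
Hypotheses (Hv : Hs0 Omega s v)
  (deta : forall t : R, is_derive t 1 eta (eta' t)) (ceta' : continuous eta')
  (eta_bd : forall t, `|eta t| <= M) (eta'_bd : forall t, `|eta' t| <= M).

Definition tensor_test (p : 'rV[R]_N * R) : R := eta p.2 * v p.1.
(** The time derivative of [tensor_test] as a curve in [H^{-s}]. *)
Definition tensor_test_t (t : R) (u : 'rV[R]_N -> R) : R :=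
  eta' t * pairing Omega v u.

Let ceta : continuous eta.
Proof.
move=> t; apply/differentiable_continuous/derivable1_diffP.
by apply: ex_derive; exact: deta.
Qed.

Let meta : measurable_fun setT eta. Proof. exact: continuous_measurable_fun. Qed.
Let meta' : measurable_fun setT eta'. Proof. exact: continuous_measurable_fun. Qed.
Let sv : sqint leb v. Proof. by have [/HsP[]] := Hv. Qed.

Lemma tensor_test_L2_Hs0 : L2_Hs0 Omega s T tensor_test.
Proof.
split.
  apply: measurable_funTS; apply: measurable_funM.
    exact: measurableT_comp meta measurable_snd.
  by apply: measurableT_comp measurable_fst; case: sv.
apply: (@bochner_L2_scaled _ T _ _ _ (fun c x => c * v x) (Hs0_norm s v) _ _ _ eta M) => //.
- by move=> c; exact: Hs0_scale.
- move=> a b; rewrite -Hs0_norm_scale//; last by case: Hv.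
  by congr Hs0_norm; apply/funext => x; rewrite mulrBl.
- by apply/funext => x; rewrite mul0r.
Qed.

Lemma tensor_test_t_L2_dual : L2_Hs0_dual Omega s T tensor_test_t.
Proof.
apply: (@bochner_L2_scaled _ T _ _ _ (fun c u => c * pairing Omega v u)
  (Hs0_dual_norm Omega s (pairing Omega v)) _ _ _ eta' M) => //.
- by move=> c; exact: pairing_dual.
- move=> a b; rewrite -Hs0_dual_norm_pairing//.
  by congr Hs0_dual_norm; apply/funext => x; rewrite mulrBl.
- by apply/funext => x; rewrite mul0r.
Qed.

Lemma tensor_test_time_derivative : time_derivative Omega s T tensor_test tensor_test_t.
Proof.
move=> theta w ttheta [/HsP[sw _] _].
have -> : \int[L1]_(t in `]0, T[) (\int[leb]_(x in Omega)
    (tensor_test (x, t) * w x) * derive1 theta t) =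
    pairing Omega v w * \int[L1]_(t in `]0, T[) (eta t * derive1 theta t).
  rewrite -RintegralZl//; last first.
    apply: continuous_integrable_oo => t; apply: cvgM; first exact: ceta.
    exact: (proj2 (test_function_continuous ttheta)).
  apply: eq_Rintegral => t _; rewrite mulrA; congr (_ * _).
  rewrite mulrC !pairingE//.
  have sv' := sqint_restrict (open_rV_measurable oO) sv.
  rewrite -RintegralZl//; last exact: sqintM.
  rewrite Rintegral_mkcond; apply: eq_Rintegral => x _; rewrite !patchE.
  by case: ifP => _; rewrite /tensor_test/= ?mul0r ?mulr0//; ring.
rewrite (test_function_parts T0 deta ceta' ttheta) mulrN; congr (- _).
rewrite -RintegralZl//; last first.
  apply: continuous_integrable_oo => t; apply: cvgM; first exact: ceta'.
  exact: (proj1 (test_function_continuous ttheta)).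
by apply: eq_Rintegral => t _; rewrite /tensor_test_t; ring.
Qed.

Lemma tensor_test_W : W Omega s T tensor_test.
Proof.
split; first exact: tensor_test_L2_Hs0.
exists tensor_test_t; [exact: tensor_test_t_L2_dual|exact: tensor_test_time_derivative].
Qed.

(** [eta] is continuous, hence so is [t |-> eta t * v] with values in
[L^2(Omega)]: its values at fixed times are the pointwise ones. *)
Lemma tensor_test_time_value t0 : 0 <= t0 <= T ->
  time_value Omega T tensor_test t0 (fun x => eta t0 * v x).
Proof.
move=> t0T; exists (at_time tensor_test); split.
- have sv' := sqint_restrict (open_rV_measurable oO) sv.
  split=> [t _|t1 _].
    apply/Lfun2P; have := sqintZ (eta t) sv'; congr sqint.
    by apply/funext => x; rewrite !patchE; case: ifP; rewrite ?mulr0.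
  have Lv : v \_ Omega \in Lfun leb 2%:E by apply/Lfun2P.
  pose F := Lfun_Sub (lee1n 2 : (1 <= 2%:E)%E) Lv.
  have E t : L2_Omega_norm Omega (at_time tensor_test t - at_time tensor_test t1) =
      (`|eta t - eta t1|%:E * L2_Omega_norm Omega v)%E.
    have := LnormZ F (eta t - eta t1); rewrite /L2_Omega_norm => <-.
    congr Lnorm; apply/funext => x /=; congr EFin; rewrite /GRing.scale/=.
    rewrite !patchE; case: ifP => _; rewrite ?mulr0//.
    by rewrite /at_time /tensor_test/= mulrBl.
  under eq_fun do rewrite E.
  have Nfin : L2_Omega_norm Omega v \is a fin_num.
    rewrite ge0_fin_numE ?Lnorm_ge0//.
    by move: (Lv); rewrite inE => /andP[_]; rewrite inE.
  rewrite -(fineK Nfin); under eq_fun do rewrite -EFinM.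
  apply: cvg_EFin; first exact: nearW.
  have -> : 0%R = `|eta t1 - eta t1| * fine (L2_Omega_norm Omega v).
    by rewrite subrr normr0 mul0r.
  apply: cvgMl; apply: cvg_norm; apply: cvgB; last exact: cvg_cst.
  by apply: cvg_within_filter; exact: ceta.
- by apply: aeW => t _; exact: aeW.
- exact: aeW.
Qed.

Lemma tensor_test_HQ : eta T = 0 -> HQ Omega s T tensor_test.
Proof.
move=> eT; split; first exact: tensor_test_W.
have := @tensor_test_time_value T; rewrite lexx (ltW T0) => /(_ isT).
by congr time_value; apply/funext => x; rewrite eT mul0r.
Qed.

End tensor_test.

(** * Weighted averages in time *)

Section time_average.
Context d1 (T1 : measurableType d1) (R : realType).
Variable m1 : {sigma_finite_measure set T1 -> \bar R}.
Variable T : R.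
Local Notation L1 := (@lebesgue_measure R).

(** The vector-valued integral of [h t * g (., t)], computed pointwise in [x]. *)
Definition tavg (h : R -> R) (g : T1 * R -> R) (x : T1) : R :=
  \int[L1]_t (h t * g (x, t)).

(** Functions extended by zero in time can be integrated against functions [h]
defined on the whole line: only [h] on [0 < t < T] matters, see [strip_mul]. *)
Definition in_strip (g : T1 * R -> R) := forall x t, ~ (0 < t < T) -> g (x, t) = 0.

Lemma sqint_cutoff (h : R -> R) M : measurable_fun setT h -> (forall t, `|h t| <= M) ->
  sqint L1 (h \_ `]0, T[).
Proof.
move=> mh hM; split.
  by apply/(measurable_restrictT _ _).1 => //; exact: measurable_funTS.
have -> : (\int[L1]_t ((h \_ `]0%R, T[) t ^+ 2)%:E =
    \int[L1]_(t in `]0%R, T[) (h t ^+ 2)%:E)%E.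
  rewrite [RHS]integral_mkcond; apply: eq_integral => t _.
  by rewrite !patchE; case: ifP => // _; rewrite expr0n.
apply: (@le_lt_trans _ _ (\int[L1]_(t in `]0%R, T[) (cst (M ^+ 2)%:E t))%E).
  apply: ge0_le_integral => //.
  - by move=> t _; rewrite lee_fin sqr_ge0.
  - by apply/measurable_EFinP; apply: measurable_funTS; exact: measurable_funX.
  - move=> t _; rewrite lee_fin -real_normK ?num_real// ler_pXn2r ?nnegrE//.
    exact: le_trans (hM t).
rewrite integral_cst//= lebesgue_measure_itv/=; case: ifPn => _.
  by rewrite -EFinB -EFinM ltry.
by rewrite mule0 ltry.
Qed.

Variables (g : T1 * R -> R).
Hypotheses (sg : sqint (m1 \x L1)%E g) (g0 : in_strip g).

Lemma strip_mul (h : R -> R) x t : h t * g (x, t) = (h \_ `]0, T[) t * g (x, t).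
Proof.
rewrite patchE; case: ifPn => //; rewrite notin_setE/= in_itv/= => /g0 ->.
by rewrite !mulr0.
Qed.

Variables (h : R -> R) (M : R).
Hypotheses (mh : measurable_fun setT h) (hM : forall t, `|h t| <= M).

Lemma ae_integrable_tavg :
  {ae m1, forall x, L1.-integrable setT (fun t => (h t * g (x, t))%:E)}.
Proof.
apply: filterS (sqint_ae_section sg) => x sgx.
under eq_fun do rewrite strip_mul.
exact: sqintM (sqint_cutoff mh hM) sgx.
Qed.

Lemma measurable_tavg : measurable_fun setT (tavg h g).
Proof.
apply: measurable_fineT; apply: (measurable_integral_snd L1 (f := fun p => h p.2 * g p)).
apply: measurable_funM; last by case: sg.
exact: measurableT_comp.
Qed.

(** Cauchy-Schwarz in time:
[(tavg h g x)^2 <= \int_0^T h^2 * \int g (x, t)^2 dt]; integrate in [x]. *)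
Lemma sqint_tavg : sqint m1 (tavg h g).
Proof.
split; first exact: measurable_tavg.
have sh := sqint_cutoff mh hM.
have mg2 : measurable_fun setT (fun p => (g p ^+ 2)%:E).
  by apply/measurable_EFinP; apply: measurable_funX; case: sg.
have mF := measurable_integral_snd L1 (f := fun p => g p ^+ 2).
pose H := \int[L1]_t ((h \_ `]0, T[) t ^+ 2).
have H0 : 0 <= H by apply: Rintegral_ge0 => t _; exact: sqr_ge0.
apply: (@le_lt_trans _ _ (\int[m1]_x (H%:E * \int[L1]_t (g (x, t) ^+ 2)%:E))%E).
  apply: ae_ge0_le_integral => //.
  - by move=> x _; rewrite lee_fin sqr_ge0.
  - by apply/measurable_EFinP; apply: measurable_funX; exact: measurable_tavg.
  - move=> x _; apply: mule_ge0 => //; apply: integral_ge0 => t _.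
    by rewrite lee_fin sqr_ge0.
  - by apply: measurable_funeM; apply: mF; apply: measurable_funX; case: sg.
  apply: filterS (sqint_ae_section sg) => x sgx _.
  rewrite -(fineK (integrable_fin_num measurableT (sqint_integrable_sqr sgx))).
  rewrite -EFinM lee_fin; apply: le_trans (Rintegral_cauchy_schwarz sh sgx).
  by rewrite /tavg; under eq_Rintegral do rewrite strip_mul.
rewrite ge0_integralZl; [|by []|by apply: mF; apply: measurable_funX; case: sg| |by []].
- apply: lte_mul_pinfty => //.
  have [_ gi] := sg; apply: le_lt_trans gi.
  by rewrite [leRHS]fubini_tonelli1//= => p; rewrite lee_fin sqr_ge0.
- by move=> x _; apply: integral_ge0 => t _; rewrite lee_fin sqr_ge0.
Qed.

Lemma tavg_fubini (v : T1 -> R) : sqint m1 v ->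
  (m1 \x L1)%E.-integrable setT (fun p => (h p.2 * (v p.1 * g p))%:E) /\
  \int[(m1 \x L1)%E]_p (h p.2 * (v p.1 * g p)) = \int[m1]_x (v x * tavg h g x).
Proof.
move=> sv; have st := sqint_tensor sv (sqint_cutoff mh hM).
have E p : h p.2 * (v p.1 * g p) = v p.1 * (h \_ `]0, T[) p.2 * g p.
  by case: p => x t /=; rewrite mulrCA strip_mul mulrA.
have I : (m1 \x L1)%E.-integrable setT (fun p => (h p.2 * (v p.1 * g p))%:E).
  by under eq_fun do rewrite E; exact: sqintM.
split => //; rewrite Rfubini_fst//.
have mvhg : measurable_fun setT (fun p : T1 * R => h p.2 * (v p.1 * g p)).
  by apply/measurable_EFinP; exact: (measurable_int _ I).
apply: ae_eq_Rintegral.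
- by apply: measurable_fineT; exact: (measurable_integral_snd L1 mvhg).
- by apply: measurable_funM measurable_tavg; case: sv.
apply: filterS ae_integrable_tavg => x Ix.
by rewrite -RintegralZl//; apply: eq_Rintegral => t _ /=; ring.
Qed.

End time_average.

(** * Curves of finite energy *)

Section finite_energy.
Context (R : realType) (N : nat) (Omega : set 'rV[R]_N) (s T : R).
Hypotheses (s01 : 0 < s < 1) (N1 : (1 <= N)%N).
Hypotheses (oO : open Omega) (bO : bounded_set Omega).
Local Notation E := 'rV[R]_N.
Local Notation leb := (@lebesgue_rV R N).
Local Notation L1 := (@lebesgue_measure R).
Local Notation leb2 := (product_sfm leb leb).
Local Notation dq := (@diffq R N s).

(** The difference quotient in space, as a function on [(R^N * R^N) * R]: it is
square-integrable exactly when the [H^s_0] norm is so in time. *)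
Definition tdiffq (u : E * R -> R) (p : (E * E) * R) : R :=
  dq (at_time u p.2) p.1.

(** What the proof needs to know of an element of [L^2(0, T; H^s_0)], stated
with Lebesgue integrals over products only. *)
Definition finite_energy (u : E * R -> R) :=
  [/\ in_strip T u, sqint (leb \x L1)%E u,
    sqint (leb2 \x L1)%E (tdiffq u) &
    {ae (leb \x L1)%E, forall p, ~ Omega p.1 -> u p = 0}].

Lemma finite_energyB u w : finite_energy u -> finite_energy w ->
  finite_energy (fun p => u p - w p).
Proof.
move=> [u0 su du uO] [w0 sw dw wO]; split.
- by move=> x t xt; rewrite u0// w0// subrr.
- exact: sqintB.
- have := sqintB du dw; congr sqint; apply/funext => p.
  by rewrite /tdiffq /diffq /at_time; ring.
- by move: uO wO; apply: ae_imp2 => p up wp Op; rewrite up// wp// subrr.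
Qed.

Lemma measurable_tdiffq u : measurable_fun setT u -> measurable_fun setT (tdiffq u).
Proof.
move=> mu; apply: measurable_funM; last first.
  apply: (@measurableT_comp _ _ _ _ _ _ (fun z : E * E => Num.sqrt (gkernel s z)) _
    (fun p : (E * E) * R => p.1)); last exact: measurable_fst.
  exact: measurable_sqrt_gkernel.
apply: measurable_funB; apply: (measurableT_comp mu).
  apply/measurable_fun_pairP; split; last exact: measurable_snd.
  exact: (measurableT_comp measurable_fst measurable_fst).
apply/measurable_fun_pairP; split; last exact: measurable_snd.
exact: (measurableT_comp measurable_snd measurable_fst).
Qed.

Lemma in_strip_tdiffq u : in_strip T u -> in_strip T (tdiffq u).
Proof.
by move=> u0 z t zt; rewrite /tdiffq /diffq /at_time/= !u0// subrr mul0r.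
Qed.

Section averages.
Variables (u : E * R -> R) (h : R -> R) (M : R).
Hypotheses (fu : finite_energy u).
Hypotheses (mh : measurable_fun setT h) (hM : forall t, `|h t| <= M).

(** The difference quotient is linear, so it commutes with the average wherever
the integrals at both points converge. *)
Lemma diffq_tavg : {ae (leb \x leb)%E, forall z, dq (tavg h u) z = tavg h (tdiffq u) z}.
Proof.
have [u0 su _ _] := fu; have := ae_integrable_tavg su u0 mh hM => aeI.
have := ae_snd leb aeI; have := ae_fst leb aeI; apply: ae_imp2 => z I1 I2.
have IB := integrableB measurableT I1 I2.
rewrite /diffq /tavg -RintegralB// -RintegralZr//.
by apply: eq_Rintegral => t _; rewrite /tdiffq /diffq /at_time/=; ring.
Qed.

(** By [diffq_tavg] the energy of the average is an [L^2] norm of an average of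
quotients, which [sqint_tavg] bounds. *)
Lemma tavg_Hs0 : Hs0 Omega s (tavg h u).
Proof.
have [u0 su du uO] := fu.
have mt := measurable_tavg su mh.
split; last first.
  apply: ae_imp (ae_xsection uO) => x ux Ox.
  rewrite /tavg /Rintegral (ae_eq_integral (cst 0%E))//=.
  - by rewrite integral0.
  - apply/measurable_EFinP; apply: measurable_funM => //.
    exact: measurableT_comp (proj1 su) (measurable_pair1 _).
  - by apply: ae_imp ux => t ux _; rewrite ux// mulr0.
apply/HsP; split; first exact: (sqint_tavg su u0 mh hM).
have [mg gi] := sqint_tavg du (in_strip_tdiffq u0) mh hM.
have md : measurable_fun setT (dq (tavg h u)) by exact: measurable_diffq.
split => //; rewrite (ge0_ae_eq_integral (g := fun z => (tavg h (tdiffq u) z ^+ 2)%:E))//.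
- by apply/measurable_EFinP; exact: measurable_funX.
- by apply/measurable_EFinP; exact: measurable_funX.
- by move=> z _; rewrite lee_fin sqr_ge0.
- by move=> z _; rewrite lee_fin sqr_ge0.
- by apply: ae_imp diffq_tavg => z -> _.
Qed.

Lemma tavg_fubini_diffq (v : E -> R) : Hs s v ->
  (leb2 \x L1)%E.-integrable setT
    (fun p => (h p.2 * (dq v p.1 * tdiffq u p))%:E) /\
  \int[(leb2 \x L1)%E]_p (h p.2 * (dq v p.1 * tdiffq u p)) =
  \int[(leb \x leb)%E]_z (dq v z * dq (tavg h u) z).
Proof.
move=> /HsP[_ dv]; have [u0 su du uO] := fu.
have [I ->] := tavg_fubini du (in_strip_tdiffq u0) mh hM dv; split => //.
have mt := measurable_tavg su mh.
apply: ae_eq_Rintegral.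
- apply: measurable_funM; first by case: dv.
  exact: (measurable_tavg du mh).
- by apply: measurable_funM; [case: dv|exact: measurable_diffq].
- by apply: ae_imp diffq_tavg => z ->.
Qed.

End averages.

End finite_energy.

Section energy_of_L2_Hs0.
Context (R : realType) (N : nat) (Omega : set 'rV[R]_N) (s T : R).
Hypotheses (s01 : 0 < s < 1) (N1 : (1 <= N)%N).
Hypotheses (oO : open Omega) (bO : bounded_set Omega).
Local Notation E := 'rV[R]_N.
Local Notation leb := (@lebesgue_rV R N).
Local Notation L1 := (@lebesgue_measure R).
Local Notation leb2 := (product_sfm leb leb).
Local Notation dq := (@diffq R N s).

Definition strip : set (E * R) := setT `*` `]0, T[.

Lemma at_time_strip (rho : E * R -> R) t : 0 < t < T ->
  at_time (rho \_ strip) t = at_time rho t.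
Proof.
move=> t0T; apply/funext => x; rewrite /at_time patchE mem_set//.
Qed.

Lemma in_strip_restrict (rho : E * R -> R) : in_strip T (rho \_ strip).
Proof.
move=> x t xt; rewrite patchE memNset// => -[_ /=].
by rewrite in_itv.
Qed.

(** Integrate in time the energy at time [t]; square-integrability of the
function itself comes from the Poincare inequality at almost every time. *)
Lemma L2_Hs0_finite_energy (rho : E * R -> R) : L2_Hs0 Omega s T rho ->
  finite_energy Omega s T (rho \_ strip).
Proof.
move=> [mrho [aeH _ normfin]].
set u := rho \_ strip.
have mstrip : measurable strip by apply: measurableX => //; exact: measurable_itv.
have mu : measurable_fun setT u by apply/(measurable_restrictT _ _).1.
have u0 : in_strip T u := in_strip_restrict rho.
have md : measurable_fun setT (tdiffq s u) := measurable_tdiffq s mu.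
have md2 : measurable_fun setT (fun p => (tdiffq s u p ^+ 2)%:E).
  by apply/measurable_EFinP; exact: measurable_funX.
have mu2 : measurable_fun setT (fun p => (u p ^+ 2)%:E).
  by apply/measurable_EFinP; exact: measurable_funX.
(* [G t] is [2 / C_{N,s}] times the squared norm at time [t], but it takes values
   in the extended reals and is visibly measurable. *)
pose G t := (\int[(leb \x leb)%E]_z (tdiffq s u (z, t) ^+ 2)%:E)%E.
have mG : measurable_fun setT G.
  apply: (measurable_integral_fst leb2 (f := fun p => tdiffq s u p ^+ 2)).
  exact: measurable_funX.
have G0 t : (0 <= G t)%E by apply: integral_ge0 => z _; rewrite lee_fin sqr_ge0.
have c0 := C_Ns_gt0 N s01.
have GN t : 0 < t < T -> Hs0_norm s (at_time rho t) ^+ 2 = C_Ns N s / 2 * fine (G t).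
  move=> tT; rewrite Hs0_norm_sqr// FformE; congr (_ * fine _).
  by apply: eq_integral => z _; rewrite /tdiffq/= at_time_strip// expr2.
have Hu : {ae L1, forall t, Hs0 Omega s (at_time u t)}.
  apply: ae_imp aeH => t Ht; have [tT|tT] := pselect (0 < t < T).
    by rewrite at_time_strip//; exact: Ht.
  rewrite (_ : at_time u t = fun=> 0); first exact: Hs0_zero.
  by apply/funext => x; exact: u0.
have Gfin : (\int[L1]_t G t < +oo)%E.
  have -> : (\int[L1]_t G t = \int[L1]_(t in `]0%R, T[)
      ((2 / C_Ns N s)%:E * (Hs0_norm s (at_time rho t) ^+ 2)%:E))%E.
    rewrite [RHS]integral_mkcond; apply: ge0_ae_eq_integral => //.
    - apply/(measurable_restrictT _ _).1 => //; apply: measurable_funeM.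
      apply: (eq_measurable_fun (fun t => (C_Ns N s / 2 * fine (G t))%:E)).
        by move=> t; rewrite inE/= in_itv/= => tT; rewrite GN.
      apply: measurable_funTS; apply/measurable_EFinP; apply: measurable_funM => //.
      exact: measurable_fineT.
    - move=> t _; rewrite patchE; case: ifP => // _.
      by rewrite -EFinM lee_fin mulr_ge0 ?sqr_ge0// divr_ge0// ltW.
    - apply: ae_imp Hu => t [/HsP[_ Hut] _] _; rewrite patchE; case: ifPn.
        rewrite inE/= in_itv/= => tT; rewrite GN// -EFinM.
        rewrite (_ : 2 / _ * _ = fine (G t)); last by field; rewrite gt_eqF.
        rewrite fineK//; rewrite ge0_fin_numE//.
        by have [_] := Hut.
      rewrite notin_setE/= in_itv/= => tT; rewrite /G.
      under eq_integral do rewrite (in_strip_tdiffq s u0)// expr0n/=.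
      by rewrite integral0.
  rewrite ge0_integralZl//.
  - by rewrite lte_mul_pinfty// lee_fin divr_ge0// ltW.
  - apply: (eq_measurable_fun (fun t => (C_Ns N s / 2 * fine (G t))%:E)).
      by move=> t; rewrite inE/= in_itv/= => tT; rewrite GN.
    apply: measurable_funTS; apply/measurable_EFinP; apply: measurable_funM => //.
    exact: measurable_fineT.
  - by move=> t _; rewrite lee_fin sqr_ge0.
  - by rewrite lee_fin divr_ge0// ltW.
split => //.
- have /andP[s0 _] := s01; have [C C0 hC] := poincare N1 s0 bO.
  split => //; rewrite fubini_tonelli2//=; last by move=> p; rewrite lee_fin sqr_ge0.
  apply: (@le_lt_trans _ _ (\int[L1]_t (C%:E * G t))%E); last first.
    by rewrite ge0_integralZl// ?lee_fin ?(ltW C0)// lte_mul_pinfty// lee_fin ltW.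
  apply: ae_ge0_le_integral => //.
  + by move=> t _; apply: integral_ge0 => x _; rewrite lee_fin sqr_ge0.
  + apply: (measurable_integral_fst leb (f := fun p => u p ^+ 2)).
    exact: measurable_funX.
  + by move=> t _; rewrite mule_ge0// lee_fin ltW.
  + exact: measurable_funeM.
  + apply: ae_imp Hu => t [/HsP[[mut _] _] Out] _.
    exact: hC.
- split => //; rewrite (fubini_tonelli2 (m1 := leb2))//=.
  by move=> p; rewrite lee_fin sqr_ge0.
- apply: ae_prod_y.
    have -> : [set p : E * R | ~ (~ Omega p.1 -> u p = 0)] =
        ((~` Omega) `*` setT) `&` (u @^-1` (~` [set 0])).
      apply/seteqP; split => p /=; first by move=> /not_implyP[].
      by move=> [[Op _] up]; apply/not_implyP.
    apply: measurableI.
      by apply: measurableX => //; apply: measurableC; exact: open_rV_measurable.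
    rewrite -[X in measurable X]setTI; apply: mu => //.
    by apply: measurableC; exact: measurable_set1.
  by apply: ae_imp Hu => t [_].
Qed.

End energy_of_L2_Hs0.

(** * The weak formulation tested with separated variables *)

Section weak_form.
Context (R : realType) (N : nat) (Omega : set 'rV[R]_N) (s T : R).
Hypotheses (s01 : 0 < s < 1) (T0 : 0 < T) (N1 : (1 <= N)%N).
Hypotheses (oO : open Omega) (bO : bounded_set Omega).
Local Notation E := 'rV[R]_N.
Local Notation leb := (@lebesgue_rV R N).
Local Notation L1 := (@lebesgue_measure R).
Local Notation leb2 := (product_sfm leb leb).
Local Notation dq := (@diffq R N s).
Local Notation strip := (@strip R N T).

Variables (v : E -> R) (eta eta' : R -> R) (M : R).
Hypotheses (Hv : Hs0 Omega s v)
  (deta : forall t : R, is_derive t 1 eta (eta' t)) (ceta' : continuous eta')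
  (eta_bd : forall t, `|eta t| <= M) (eta'_bd : forall t, `|eta' t| <= M).

Let meta : measurable_fun setT eta.
Proof.
apply: continuous_measurable_fun => t.
by apply/differentiable_continuous/derivable1_diffP/ex_derive; exact: deta.
Qed.
Let meta' : measurable_fun setT eta'. Proof. exact: continuous_measurable_fun. Qed.
Let sv : sqint leb v. Proof. by have [/HsP[]] := Hv. Qed.

(** Fubini: the integral in time of [eta' t * \int v rho(t)] is the pairing of
[v] with the average of [rho].  Integrating over [Omega] or over the whole space
is the same, because [v] vanishes outside [Omega]. *)
Lemma time_term (rho : E * R -> R) : L2_Hs0 Omega s T rho ->
  \int[L1]_(t in `]0, T[) tensor_test_t Omega v eta' t (at_time rho t) =
  \int[leb]_x (v x * tavg eta' (rho \_ strip) x).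
Proof.
move=> /(L2_Hs0_finite_energy s01 N1 oO bO)[u0 su _ _].
set u := rho \_ strip in u0 su *.
have [mu _] := su; have [mv _] := sv.
have [I <-] := tavg_fubini su u0 meta' eta'_bd sv.
have one_bd (t : R) : `|(fun=> 1 : R) t| <= 1 by rewrite normr1.
have [I1 _] := tavg_fubini su u0 (measurable_cst _) one_bd sv.
have mvu : measurable_fun setT (fun p : E * R => v p.1 * u p).
  by apply: measurable_funM => //; exact: measurableT_comp.
have P_E t : 0 < t < T -> pairing Omega v (at_time rho t) = \int[leb]_x (v x * u (x, t)).
  move=> tT; rewrite -(at_time_strip rho tT) pairingE//; apply: ae_eq_Rintegral.
  - apply: measurable_funM; last exact: measurableT_comp mu (measurable_pair2 _).
    apply/(measurable_restrictT _ _).1; first exact: open_rV_measurable.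
    exact: measurable_funTS.
  - apply: measurable_funM => //; exact: measurableT_comp mu (measurable_pair2 _).
  - apply: ae_imp (proj2 Hv) => x vx; rewrite patchE; case: ifPn => //.
    by rewrite notin_setE => /vx ->.
rewrite Rfubini_snd// Rintegral_mkcond; apply: ae_eq_Rintegral.
- rewrite (_ : _ \_ _ = fun t => eta' t * \int[leb]_x (v x * u (x, t))).
    apply: measurable_funM => //; apply: measurable_fineT.
    exact: (measurable_integral_fst leb mvu).
  apply/funext => t; rewrite patchE; case: ifPn.
    by rewrite inE/= in_itv/= => tT; rewrite /tensor_test_t P_E.
  rewrite notin_setE/= in_itv/= => tT.
  rewrite /Rintegral (eq_integral (cst 0%E)) ?integral0 ?mulr0// => x _.
  by rewrite u0// mulr0.
- apply: measurable_fineT.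
  apply: (measurable_integral_fst leb (f := fun p => eta' p.2 * (v p.1 * u p))).
  by apply: measurable_funM => //; exact: (measurableT_comp meta' measurable_snd).
apply: ae_imp (ae_integrable2 I1) => t It; rewrite patchE.
have {}It : leb.-integrable setT (fun x => (v x * u (x, t))%:E).
  by move: It; apply: eq_integrable => // x _; rewrite /= mul1r.
rewrite (RintegralZl (eta' t) measurableT It); case: ifPn.
  by rewrite inE/= in_itv/= => tT; rewrite /tensor_test_t P_E.
rewrite notin_setE/= in_itv/= => tT.
rewrite /Rintegral (eq_integral (cst 0%E)) ?integral0 ?mulr0// => x _.
by rewrite u0// mulr0.
Qed.

Lemma space_term (rho : E * R -> R) : L2_Hs0 Omega s T rho ->
  \int[L1]_(t in `]0, T[) Fform s (at_time rho t) (at_time (tensor_test v eta) t) =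
  C_Ns N s / 2 * \int[(leb \x leb)%E]_z (dq v z * dq (tavg eta (rho \_ strip)) z).
Proof.
move=> /(L2_Hs0_finite_energy s01 N1 oO bO) fu.
set u := rho \_ strip in fu *.
have [u0 su du _] := fu; have [mtd _] := du.
have [I <-] := tavg_fubini_diffq fu meta eta_bd (proj1 Hv).
set f := fun p : (E * E) * R => eta p.2 * (dq v p.1 * tdiffq s u p) in I *.
have mf : measurable_fun setT f.
  by apply/measurable_EFinP; exact: (measurable_int _ I).
rewrite -RintegralZl// Rfubini_snd; last first.
  by have := integrableZl measurableT (C_Ns N s / 2) I.
rewrite Rintegral_mkcond.
have E t : ((fun t => Fform s (at_time rho t) (at_time (tensor_test v eta) t))
    \_ `]0, T[) t = C_Ns N s / 2 * \int[(leb \x leb)%E]_z f (z, t).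
  rewrite patchE; case: ifPn.
    rewrite inE/= in_itv/= => tT; rewrite FformE; congr (_ * _).
    apply: eq_Rintegral => z _; rewrite /f /tdiffq/= at_time_strip//.
    by rewrite /diffq /at_time /tensor_test/=; ring.
  rewrite notin_setE/= in_itv/= => tT.
  rewrite /Rintegral (eq_integral (cst 0%E)) ?integral0 ?mulr0// => z _.
  by rewrite /f/= (in_strip_tdiffq s u0)// !mulr0.
apply: ae_eq_Rintegral.
- rewrite (funext E); apply: measurable_funM => //; apply: measurable_fineT.
  exact: (measurable_integral_fst leb2 mf).
- apply: measurable_fineT; apply: (measurable_integral_fst leb2
    (f := fun p => C_Ns N s / 2 * f p)).
  exact: measurable_funM.
apply: ae_imp (ae_integrable2 I) => t It; rewrite E.
by rewrite RintegralZl.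
Qed.

(** The test function is [eta t * v x]; Fubini turns both integrals in time of
the weak formulation into averages of [rho]. *)
Lemma weak_form f rho0 (rho : E * R -> R) : eta T = 0 ->
  weak_solution Omega s T f rho0 rho ->
  - (\int[leb]_x (v x * tavg eta' (rho \_ strip) x)) +
  C_Ns N s / 2 * \int[(leb \x leb)%E]_z (dq v z * dq (tavg eta (rho \_ strip)) z) =
  \int[(leb \x L1)%E]_(p in cylinder Omega T) (f p * tensor_test v eta p) +
  \int[leb]_(x in Omega) (rho0 x * (eta 0 * v x)).
Proof.
move=> eT [[Lrho _] wk].
rewrite -time_term// -space_term//; apply: wk.
- exact: (tensor_test_HQ s01 T0 N1 oO bO Hv deta ceta' eta_bd eta'_bd eT).
- exact: (tensor_test_t_L2_dual T s01 N1 oO bO Hv ceta' eta'_bd).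
- exact: (tensor_test_time_derivative T0 oO Hv deta ceta').
- by apply: (tensor_test_time_value oO Hv deta); rewrite lexx ltW.
Qed.

End weak_form.

Section comparison_inequality.
Context (R : realType) (N : nat) (Omega : set 'rV[R]_N) (s T : R).
Hypotheses (s01 : 0 < s < 1) (T0 : 0 < T) (N1 : (1 <= N)%N).
Hypotheses (oO : open Omega) (bO : bounded_set Omega).
Local Notation E := 'rV[R]_N.
Local Notation leb := (@lebesgue_rV R N).
Local Notation L1 := (@lebesgue_measure R).
Local Notation leb2 := (product_sfm leb leb).
Local Notation dq := (@diffq R N s).
Local Notation strip := (@strip R N T).

(** The inequality [u_t + (-Delta)^s u >= 0] with [u >= 0] at time [0], tested
with nonnegative separated functions that vanish at the final time. *)
Definition supersolution (u : E * R -> R) :=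
  forall (v : E -> R) (eta eta' : R -> R) (M : R),
  Hs0 Omega s v -> (forall x, 0 <= v x) ->
  (forall t : R, is_derive t 1 eta (eta' t)) -> continuous eta' ->
  (forall t, 0 <= eta t) ->
  (forall t, `|eta t| <= M) -> (forall t, `|eta' t| <= M) -> eta T = 0 ->
  0 <= - (\int[leb]_x (v x * tavg eta' u x)) +
    C_Ns N s / 2 * \int[(leb \x leb)%E]_z (dq v z * dq (tavg eta u) z).

Lemma ae_Rintegral_ge0 (d : measure_display) (X : measurableType d)
    (mu : {measure set X -> \bar R}) (D : set X) (f : X -> R) :
  measurable D -> mu.-integrable D (EFin \o f) ->
  {ae mu, forall x, D x -> 0 <= f x} -> 0 <= \int[mu]_(x in D) f x.
Proof.
move=> mD If f0.
have -> : \int[mu]_(x in D) f x = \int[mu]_(x in D) `|f x|.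
  congr fine; apply: ae_eq_integral => //.
  - exact: (measurable_int _ If).
  - by apply: (measurable_int mu); exact: (integrable_norm If).
  - by apply: ae_imp f0 => x fx /fx f0; rewrite ger0_norm.
exact: Rintegral_ge0.
Qed.

Section data.
Variables (v : E -> R) (eta : R -> R) (M : R).
Hypotheses (Hv : Hs0 Omega s v) (meta : measurable_fun setT eta).
Hypotheses (eta_bd : forall t, `|eta t| <= M).

Lemma measurable_cylinder :
  measurable (cylinder Omega T : set (E * measurableTypeR R)%type).
Proof.
by apply: measurableX; [exact: open_rV_measurable|exact: measurable_itv].
Qed.

Lemma source_integrable f : L2_Q Omega T f ->
  (leb \x L1)%E.-integrable (cylinder Omega T) (fun p => (f p * tensor_test v eta p)%:E).
Proof.
move=> /Lfun2P sf; have [/HsP[sv _] _] := Hv.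
have := sqintM sf (sqint_tensor sv (sqint_cutoff T meta eta_bd)).
move=> I; have {I} := integrableS measurableT measurable_cylinder (@subsetT _ _) I.
apply: eq_integrable; first exact: measurable_cylinder.
move=> [x t] xtQ; rewrite /tensor_test /= patchE xtQ; congr EFin; congr (_ * _).
move: xtQ; rewrite inE => -[/= _ tT]; rewrite patchE mem_set//.
by rewrite mulrC.
Qed.

Lemma initial_integrable rho0 : L2_Omega Omega rho0 ->
  leb.-integrable Omega (fun x => (rho0 x * (eta 0 * v x))%:E).
Proof.
move=> /Lfun2P sr; have [/HsP[sv _] _] := Hv.
have := sqintM sr (sqintZ (eta 0) sv).
move=> I; have {I} := integrableS measurableT (open_rV_measurable oO) (@subsetT _ _) I.
apply: eq_integrable; first exact: open_rV_measurable.
by move=> x xO; rewrite /= patchE xO.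
Qed.

End data.

Lemma supersolution_of_solution f rho0 rho :
  L2_Q Omega T f -> L2_Omega Omega rho0 ->
  weak_solution Omega s T f rho0 rho ->
  {ae (leb \x L1)%E, forall p, cylinder Omega T p -> 0 <= f p} ->
  {ae leb, forall x, Omega x -> 0 <= rho0 x} ->
  supersolution (rho \_ strip).
Proof.
move=> Lf Lr sol f0 r0 v eta eta' M Hv v0 deta ceta' e0 eM e'M eT.
have meta : measurable_fun setT eta.
  apply: continuous_measurable_fun => t.
  by apply/differentiable_continuous/derivable1_diffP/ex_derive; exact: deta.
rewrite (weak_form s01 T0 N1 oO bO Hv deta ceta' eM e'M eT sol) addr_ge0//.
  apply: ae_Rintegral_ge0.
  - exact: measurable_cylinder.
  - exact: (source_integrable Hv meta eM Lf).
  - by apply: ae_imp f0 => p fp /fp f0; rewrite !mulr_ge0.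
apply: ae_Rintegral_ge0.
- exact: open_rV_measurable.
- exact: (initial_integrable eta Hv Lr).
- by apply: ae_imp r0 => x rx /rx r0; rewrite !mulr_ge0.
Qed.

(** Subtract the two instances of [weak_form]; the differences of the data are
nonnegative and so is the test function. *)
Lemma supersolution_of_difference f rho0 rho f' rho0' rho' :
  L2_Q Omega T f -> L2_Omega Omega rho0 -> weak_solution Omega s T f rho0 rho ->
  L2_Q Omega T f' -> L2_Omega Omega rho0' -> weak_solution Omega s T f' rho0' rho' ->
  {ae (leb \x L1)%E, forall p, cylinder Omega T p -> f p <= f' p} ->
  {ae leb, forall x, Omega x -> rho0 x <= rho0' x} ->
  supersolution (fun p => (rho' \_ strip) p - (rho \_ strip) p).
Proof.
move=> Lf Lr sol Lf' Lr' sol' ff rr v eta eta' M Hv v0 deta ceta' e0 eM e'M eT.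
have meta : measurable_fun setT eta.
  apply: continuous_measurable_fun => t.
  by apply/differentiable_continuous/derivable1_diffP/ex_derive; exact: deta.
have meta' : measurable_fun setT eta' by exact: continuous_measurable_fun.
have [[Lrho _] _] := sol; have [[Lrho' _] _] := sol'.
have fu := L2_Hs0_finite_energy s01 N1 oO bO Lrho.
have fu' := L2_Hs0_finite_energy s01 N1 oO bO Lrho'.
have := weak_form s01 T0 N1 oO bO Hv deta ceta' eM e'M eT sol.
have := weak_form s01 T0 N1 oO bO Hv deta ceta' eM e'M eT sol'.
set u := rho \_ strip in fu *; set u' := rho' \_ strip in fu' *.
have [u0 su _ _] := fu; have [u'0 su' _ _] := fu'.
have [/HsP[sv dv] _] := Hv.
have fd := finite_energyB fu' fu.
set w := fun p => u' p - u p in fd *.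
have [w0 sw _ _] := fd.
have tavgB (h : R -> R) : measurable_fun setT h -> (forall t, `|h t| <= M) ->
    {ae leb, forall x, tavg h w x = tavg h u' x - tavg h u x}.
  move=> mh hM.
  apply: ae_imp2 (ae_integrable_tavg su' u'0 mh hM) (ae_integrable_tavg su u0 mh hM).
  move=> x I1 I2; rewrite /tavg -RintegralB//.
  by apply: eq_Rintegral => t _; rewrite mulrBr.
have Hs_t (h : R -> R) q : finite_energy Omega s T q -> measurable_fun setT h ->
    (forall t, `|h t| <= M) -> sqint leb (tavg h q) /\ sqint leb2 (dq (tavg h q)).
  by move=> fq mh hM; have [/HsP] := tavg_Hs0 fq mh hM.
have time_E : \int[leb]_x (v x * tavg eta' w x) =
    \int[leb]_x (v x * tavg eta' u' x) - \int[leb]_x (v x * tavg eta' u x).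
  have [s1 _] := Hs_t _ _ fu' meta' e'M; have [s2 _] := Hs_t _ _ fu meta' e'M.
  have [s3 _] := Hs_t _ _ fd meta' e'M.
  rewrite -RintegralB//; [|exact: sqintM|exact: sqintM].
  have [mv _] := sv; have [m1 _] := s1; have [m2 _] := s2; have [m3 _] := s3.
  apply: ae_eq_Rintegral.
  - exact: measurable_funM.
  - by apply: measurable_funB; exact: measurable_funM.
  - by apply: ae_imp (tavgB _ meta' e'M) => x ->; rewrite mulrBr.
have space_E : \int[leb2]_z (dq v z * dq (tavg eta w) z) =
    \int[leb2]_z (dq v z * dq (tavg eta u') z) -
    \int[leb2]_z (dq v z * dq (tavg eta u) z).
  have [_ s1] := Hs_t _ _ fu' meta eM; have [_ s2] := Hs_t _ _ fu meta eM.
  have [_ s3] := Hs_t _ _ fd meta eM; have dv2 : sqint leb2 (dq v) := dv.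
  rewrite -(RintegralB measurableT (sqintM dv2 s1) (sqintM dv2 s2)).
  have [mv _] := dv; have [m1 _] := s1; have [m2 _] := s2; have [m3 _] := s3.
  apply: ae_eq_Rintegral.
  - exact: measurable_funM.
  - by apply: measurable_funB; exact: measurable_funM.
  - have B := tavgB _ meta eM.
    apply: ae_imp2 (ae_fst leb B) (ae_snd leb B) => z z1 z2.
    by rewrite /diffq z1 z2; ring.
move=> e' e.
have subtract (a a' b b' c l l' : R) : - a' + c * b' = l' -> - a + c * b = l ->
    - (a' - a) + c * (b' - b) = l' - l by move=> <- <-; ring.
have := subtract _ _ _ _ _ _ _ e' e; rewrite -time_E => {e e'}.
move: space_E => <- ->; rewrite opprD addrACA.
apply: addr_ge0.
  rewrite -RintegralB//; last 3 first.
  - exact: measurable_cylinder.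
  - exact: (source_integrable Hv meta eM Lf').
  - exact: (source_integrable Hv meta eM Lf).
  apply: ae_Rintegral_ge0.
  - exact: measurable_cylinder.
  - have := integrableB measurable_cylinder (source_integrable Hv meta eM Lf')
      (source_integrable Hv meta eM Lf).
    by [].
  - apply: ae_imp ff => p fp /fp f0.
    by rewrite -mulrBl mulr_ge0 ?subr_ge0// mulr_ge0.
rewrite -RintegralB//; last 3 first.
- exact: open_rV_measurable.
- exact: (initial_integrable eta Hv Lr').
- exact: (initial_integrable eta Hv Lr).
apply: ae_Rintegral_ge0.
- exact: open_rV_measurable.
- have := integrableB (open_rV_measurable oO) (initial_integrable eta Hv Lr')
    (initial_integrable eta Hv Lr).
  by [].
- apply: ae_imp rr => x rx /rx r0.
  by rewrite -mulrBl mulr_ge0 ?subr_ge0// mulr_ge0.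
Qed.

End comparison_inequality.

(** * Decay of the negative part of smoothed supersolutions *)

Section quadratic_expansion.
Variable R : realType.

(** A quantitative form of [C^{1,1}] regularity, with derivative [k'].  It is the
bound that survives under the integral defining [smoothed], and it is stable
under the operations that build kernels, without any limit. *)
Definition quadratic_expansion (k k' : R -> R) (K : R) :=
  forall a b, `|k b - k a - (b - a) * k' a| <= K * (b - a) ^+ 2.

Variables (k k' : R -> R) (K : R).
Hypothesis kK : quadratic_expansion k k' K.

Lemma quadratic_expansion_is_derive (a : R) : is_derive a 1 k (k' a).
Proof.
have K0 : 0 <= K.
  have := le_trans (normr_ge0 _) (kK a (a + 1)).
  by rewrite addrAC subrr add0r expr1n mulr1.
have kd : h^-1 *: (k (h *: 1 + a) - k a) @[h --> 0^'] --> k' a.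
  apply/cvgrPdist_le => /= e e0.
  near=> h.
  have h0 : h != 0 by near: h; exact: nbhs_dnbhs_neq.
  have hK : `|h| * K <= e.
    rewrite (@le_trans _ _ (`|h| * (K + 1)))// ?ler_wpM2l// ?lerDl//.
    rewrite -ler_pdivlMr ?ltr_wpDl//.
    near: h; apply: dnbhs0_le; rewrite divr_gt0// ltr_wpDl//.
  rewrite distrC /GRing.scale/= mulr1.
  have -> : h^-1 * (k (h + a) - k a) - k' a =
      h^-1 * (k (h + a) - k a - (h + a - a) * k' a) by field.
  rewrite normrM normfV ler_pdivrMl ?normr_gt0//.
  apply: le_trans (kK _ _) _.
  rewrite addrK -real_normK ?num_real// expr2 mulrCA.
  by rewrite ler_wpM2l// mulrC.
split; first by apply/cvg_ex; exists (k' a).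
exact: cvg_lim.
Unshelve. all: by end_near. Qed.

(** Add the expansions at [a] and at [b]: the values of [k] cancel. *)
Lemma quadratic_expansion_lipschitz a b : `|k' b - k' a| <= 2 * K * `|b - a|.
Proof.
have [->|ab] := eqVneq a b; first by rewrite !subrr normr0 mulr0.
have d0 : 0 < `|b - a| by rewrite normr_gt0 subr_eq0 eq_sym.
rewrite -(ler_pM2l d0) -normrM.
have -> : (b - a) * (k' b - k' a) =
  (k a - k b - (a - b) * k' b) + (k b - k a - (b - a) * k' a) by ring.
apply: le_trans (ler_normD _ _) _.
apply: le_trans (lerD (kK _ _) (kK _ _)) _.
have -> : (a - b) ^+ 2 = `|b - a| ^+ 2 by rewrite real_normK ?num_real//; ring.
by rewrite -[(b - a) ^+ 2]real_normK ?num_real// le_eqVlt; apply/orP; left; apply/eqP; ring.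
Qed.

Lemma quadratic_expansion_continuous : continuous k'.
Proof.
have K0 : 0 <= K.
  have := le_trans (normr_ge0 _) (kK 0 1).
  by rewrite subr0 expr1n mulr1.
have K1 : 0 < 2 * K + 1 by rewrite ltr_wpDl// mulr_ge0.
move=> a; apply/cvgrPdist_le => /= e e0; near=> b.
apply: le_trans (quadratic_expansion_lipschitz _ _) _.
apply: (@le_trans _ _ ((2 * K + 1) * `|a - b|)).
  by rewrite ler_wpM2r// lerDl.
rewrite mulrC -ler_pdivlMr//.
near: b; apply: cvgr_dist_le; first exact: cvg_id.
exact: divr_gt0.
Unshelve. all: by end_near. Qed.

Lemma quadratic_expansion_reflect t :
  quadratic_expansion (fun x => k (t - x)) (fun x => - k' (t - x)) K.
Proof.
move=> a b; have := kK (t - a) (t - b).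
have -> : t - b - (t - a) = - (b - a) by ring.
by rewrite sqrrN mulNr mulrN.
Qed.

End quadratic_expansion.

Section negative_part.
Context (R : realType) (N : nat) (Omega : set 'rV[R]_N) (s : R).
Local Notation leb := (@lebesgue_rV R N).
Local Notation dq := (@diffq R N s).

Definition neg_part (x : R) : R := Num.max (- x) 0.

Lemma neg_part_ge0 x : 0 <= neg_part x. Proof. by rewrite le_max lexx orbT. Qed.

Lemma neg_part_norm x : neg_part x <= `|x|.
Proof. by rewrite ge_max normr_ge0 andbT -normrN ler_norm. Qed.

Lemma neg_part_lip x y : `|neg_part x - neg_part y| <= `|x - y|.
Proof.
rewrite /neg_part; have [x0|x0] := leP (- x) 0; have [y0|y0] := leP (- y) 0.
- by rewrite subrr normr0.
- rewrite sub0r opprK ltr0_norm; last lra.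
  by apply: le_trans (ler_norm _); lra.
- rewrite subr0 normrN ltr0_norm; last lra.
  by rewrite distrC; apply: le_trans (ler_norm _); lra.
- by rewrite opprK addrC distrC.
Qed.

(** The negative part is nonincreasing. *)
Lemma neg_part_mono x y : (neg_part x - neg_part y) * (x - y) <= 0.
Proof.
rewrite /neg_part; have [x0|x0] := leP (- x) 0; have [y0|y0] := leP (- y) 0.
- by rewrite subrr mul0r.
- by rewrite sub0r opprK mulr_le0_ge0//; lra.
- by rewrite subr0 mulr_ge0_le0//; lra.
- rewrite (_ : _ * _ = - (x - y) ^+ 2); last by ring.
  by rewrite oppr_le0 sqr_ge0.
Qed.

(** The negative part is a contraction fixing [0], hence it decreases both the
[L^2] norm and the difference quotients. *)
Lemma Hs0_neg_part w : Hs0 Omega s w -> Hs0 Omega s (fun x => neg_part (w x)).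
Proof.
move=> [/HsP[sw dw] w0].
have mn : measurable_fun setT (fun x => neg_part (w x)).
  by apply: measurable_maxr => //; apply: measurable_funN; case: sw.
split.
  apply/HsP; split.
    apply: sqint_le mn _ sw => x.
    by rewrite ger0_norm ?neg_part_ge0// neg_part_norm.
  apply: sqint_le (measurable_diffq s mn) _ dw => z.
  by rewrite /diffq !normrM ler_wpM2r// neg_part_lip.
by apply: ae_imp w0 => x wx Ox; rewrite wx// /neg_part oppr0 maxxx.
Qed.

Lemma diffq_neg_part_le0 w z : dq (fun x => neg_part (w x)) z * dq w z <= 0.
Proof.
rewrite /diffq mulrACA -expr2 sqr_sqrtr ?gkernel_ge0//.
by rewrite mulr_le0_ge0 ?gkernel_ge0// neg_part_mono.
Qed.

End negative_part.

Section energy_estimate.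
Context (R : realType) (N : nat) (Omega : set 'rV[R]_N) (s T : R).
Hypotheses (s01 : 0 < s < 1) (T0 : 0 < T).
Local Notation E := 'rV[R]_N.
Local Notation leb := (@lebesgue_rV R N).
Local Notation L1 := (@lebesgue_measure R).
Local Notation leb2 := (product_sfm leb leb).
Local Notation dq := (@diffq R N s).

Variables (u : E * R -> R).
Hypotheses (fu : finite_energy Omega s T u) (super : supersolution Omega s T u).

Variables (k k' : R -> R) (K M : R).
Hypotheses (kK : quadratic_expansion k k' K) (k_ge0 : forall r, 0 <= k r)
  (kM : forall r, `|k r| <= M) (k'M : forall r, `|k' r| <= M)
  (k0 : forall r, r <= 0 -> k r = 0).

Definition smoothed (t : R) : E -> R := tavg (fun r => k (t - r)) u.
(** Minus the time derivative of [smoothed]: the kernel is the derivative of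
[k (t - r)] in [r], as in the weak formulation. *)
Let smoothed_t (t : R) : E -> R := tavg (fun r => - k' (t - r)) u.
(** The [L^1] norm in time, which dominates all the averages with bounded
kernels uniformly in [t]. *)
Let mass : E -> R := tavg (fun=> 1) (fun p => `|u p|).

Let u0 : in_strip T u. Proof. by case: fu. Qed.
Let su : sqint (leb \x L1)%E u. Proof. by case: fu. Qed.
Let sau : sqint (leb \x L1)%E (fun p => `|u p|).
Proof.
apply: sqint_le _ _ su => [|p]; last by rewrite normr_id.
by apply: measurableT_comp => //; case: su.
Qed.
Let au0 : in_strip T (fun p => `|u p|).
Proof. by move=> x t tT; rewrite u0// normr0. Qed.

Let K_ge0 : 0 <= K.
Proof.
have := le_trans (normr_ge0 _) (kK 0 1).
by rewrite subr0 expr1n mulr1.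
Qed.
Let M_ge0 : 0 <= M. Proof. exact: le_trans (normr_ge0 _) (kM 0). Qed.

Let mk : measurable_fun setT k.
Proof.
apply: continuous_measurable_fun => t.
apply/differentiable_continuous/derivable1_diffP/ex_derive.
exact: (quadratic_expansion_is_derive kK).
Qed.
Let mk' : measurable_fun setT k'.
Proof. apply: continuous_measurable_fun; exact: (quadratic_expansion_continuous kK). Qed.
Let mkt (t : R) : measurable_fun setT (fun r : R => k (t - r)).
Proof. by apply: (measurableT_comp mk); apply: measurable_funB. Qed.
Let mkt' (t : R) : measurable_fun setT (fun r : R => - k' (t - r)).
Proof.
by apply: measurable_funN; apply: (measurableT_comp mk'); apply: measurable_funB.
Qed.
Let k'tM t r : `|- k' (t - r)| <= M. Proof. by rewrite normrN. Qed.
Let ktM t r : `|k (t - r)| <= M. Proof. by []. Qed.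
Let one_bd (r : R) : `|(fun=> 1 : R) r| <= 1. Proof. by rewrite normr1. Qed.

Let smass : sqint leb mass.
Proof. exact: (sqint_tavg sau au0 (measurable_cst _) one_bd). Qed.
Let ssm' t : sqint leb (smoothed_t t).
Proof. exact: (sqint_tavg su u0 (mkt' t) (k'tM t)). Qed.
Let sneg t : sqint leb (fun x => neg_part (smoothed t x)).
Proof. by have [/HsP[]] := Hs0_neg_part (tavg_Hs0 fu (mkt t) (ktM t)). Qed.

Lemma smoothed_mass t : {ae leb, forall x, `|smoothed t x| <= M * mass x}.
Proof.
apply: ae_imp2 (ae_integrable_tavg su u0 (mkt t) (ktM t))
  (ae_integrable_tavg sau au0 (measurable_cst _) one_bd) => x I1 I2.
apply: le_trans (le_normr_Rintegral measurableT I1) _.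
rewrite /mass /tavg -RintegralZl//; apply: le_Rintegral => //.
- exact: (integrable_norm I1).
- by have := integrableZl measurableT M I2.
- by move=> r _; rewrite normrM mul1r ler_wpM2r.
Qed.

(** Integrate the quadratic expansion of [k] at [t + h - r] against [u (x, r)]:
going backwards from the later time puts the derivative at [t + h], where the
dissipation inequality will be used. *)
Lemma smoothed_increment t h : {ae leb, forall x,
  `|smoothed (t + h) x - smoothed t x + h * smoothed_t (t + h) x| <=
  K * h ^+ 2 * mass x}.
Proof.
have aeI := ae_imp2 (fun x I1 I2 => conj I1 I2)
  (ae_integrable_tavg su u0 (mkt (t + h)) (ktM (t + h)))
  (ae_integrable_tavg su u0 (mkt t) (ktM t)).
have aeJ := ae_imp2 (fun x I1 I2 => conj I1 I2)
  (ae_integrable_tavg su u0 (mkt' (t + h)) (k'tM (t + h)))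
  (ae_integrable_tavg sau au0 (measurable_cst _) one_bd).
apply: ae_imp2 aeI aeJ => x [I1 I2] [I3 I4].
pose D r := k (t + h - r) * u (x, r) - k (t - r) * u (x, r) +
  h * (- k' (t + h - r) * u (x, r)).
have I12 := integrableB measurableT I1 I2.
have I3h := integrableZl measurableT h I3.
have ID : L1.-integrable setT (EFin \o D) by have := integrableD measurableT I12 I3h.
have -> : smoothed (t + h) x - smoothed t x + h * smoothed_t (t + h) x =
    \int[L1]_r D r.
  by rewrite /D RintegralD// RintegralB// RintegralZl.
apply: le_trans (le_normr_Rintegral measurableT ID) _.
rewrite /mass /tavg -RintegralZl//; apply: le_Rintegral => //.
- exact: (integrable_norm ID).
- by have := integrableZl measurableT (K * h ^+ 2) I4.
- move=> r _; rewrite mul1r.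
  have -> : D r = - (k (t - r) - k (t + h - r) - (t - r - (t + h - r)) * k' (t + h - r))
      * u (x, r) by rewrite /D; ring.
  rewrite normrM normrN ler_wpM2r//; apply: le_trans (kK _ _) _.
  by rewrite (_ : _ - (t + h - r) = - h) ?sqrrN//; ring.
Qed.

(** Test with the kernel [k (t - .)], which vanishes at [T] because [t <= T],
and with the negative part of [smoothed t] itself. *)
Lemma smoothed_dissipation t : 0 <= t <= T ->
  \int[leb]_x (neg_part (smoothed t x) * smoothed_t t x) <= 0.
Proof.
move=> /andP[t0 tT].
have Hw := tavg_Hs0 fu (mkt t) (ktM t); have Hv := Hs0_neg_part Hw.
have kt := quadratic_expansion_reflect kK t.
have := super Hv (fun x => neg_part_ge0 _) (quadratic_expansion_is_derive kt)
  (quadratic_expansion_continuous kt) (fun r => k_ge0 (t - r)) (ktM t) (k'tM t).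
rewrite k0 ?subr_le0// => /(_ erefl).
set I2 := (X in _ + _ * X) => h.
have I2_le0 : I2 <= 0.
  have [/HsP[_ dw] _] := Hw; have [/HsP[_ dv] _] := Hv.
  rewrite -oppr_ge0 /I2 -mulN1r -RintegralZl//; last exact: (sqintM dv dw).
  apply: Rintegral_ge0 => z _; rewrite mulN1r oppr_ge0.
  exact: diffq_neg_part_le0.
have c0 := C_Ns_gt0 N s01.
rewrite -oppr_ge0; apply: le_trans h _; rewrite gerDl.
by rewrite mulr_ge0_le0// divr_ge0// ltW.
Qed.

Let energy t : R := \int[leb]_x (neg_part (smoothed t x) ^+ 2).

(** A backward Euler step.  With [a], [b] the values of [w] at times [t + h] and
[t] and [a^-], [b^-] their negative parts, [-a a^- = (a^-)^2] and
[-b a^- <= b^- a^-] give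
[(a^-)^2 - (b^-)^2 <= - 2 (a - b) a^-].  Here [a - b] is [h w'(t + h)] up to
[K h^2 mass], and [w'(t + h) a^-] has a nonnegative integral. *)
Lemma energy_increment t h : 0 <= h -> 0 <= t + h <= T ->
  energy (t + h) <= energy t + 2 * K * M * h ^+ 2 * \int[leb]_x (mass x ^+ 2).
Proof.
move=> h0 thT; have diss := smoothed_dissipation thT.
have Ia := sqint_integrable_sqr (sneg (t + h)).
have Ib := sqint_integrable_sqr (sneg t).
have Im := sqint_integrable_sqr smass.
have Id := sqintM (sneg (t + h)) (ssm' (t + h)).
rewrite -subr_ge0.
have Ib' := integrableB measurableT Ib Ia.
have Id' := integrableZl measurableT (2 * h) Id.
have Im' := integrableZl measurableT (2 * K * M * h ^+ 2) Im.
have Ibd := integrableD measurableT Ib' Id'.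
have Iall := integrableD measurableT Ibd Im'.
apply: (@le_trans _ _ (\int[leb]_x ((neg_part (smoothed t x) ^+ 2 -
    neg_part (smoothed (t + h) x) ^+ 2 +
    2 * h * (neg_part (smoothed (t + h) x) * smoothed_t (t + h) x)) +
    2 * K * M * h ^+ 2 * mass x ^+ 2))).
  apply: ae_Rintegral_ge0 => //.
  have aeb := smoothed_mass (t + h); have aei := smoothed_increment t h.
  apply: ae_imp2 aeb aei => x; rewrite /=.
  set a := smoothed (t + h) x; set b := smoothed t x; set d := smoothed_t (t + h) x.
  set m := mass x => am inc _.
  have na0 := neg_part_ge0 a; have nb0 := neg_part_ge0 b.
  have nam : neg_part a <= M * m := le_trans (neg_part_norm a) am.
  have m_ge0 : 0 <= m.
    by apply: Rintegral_ge0 => r _; rewrite mul1r.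
  have Kh : 0 <= K * h ^+ 2 * m by rewrite !mulr_ge0// sqr_ge0.
  have step : (- (a - b) - h * d) * neg_part a <= K * M * h ^+ 2 * m ^+ 2.
    apply: (@le_trans _ _ (K * h ^+ 2 * m * (M * m))); last first.
      by rewrite le_eqVlt; apply/orP; left; apply/eqP; ring.
    apply: (@le_trans _ _ (K * h ^+ 2 * m * neg_part a)).
      rewrite ler_wpM2r//; move: inc; rewrite ler_norml => /andP[+ _]; lra.
    by rewrite ler_wpM2l.
  have na : a * neg_part a = - neg_part a ^+ 2.
    by rewrite /neg_part; have [a0|a0] := leP (- a) 0; ring.
  have nb : - b * neg_part a <= neg_part b * neg_part a.
    by rewrite ler_wpM2r// le_max lexx.
  have sq := sqr_ge0 (neg_part a - neg_part b).
  move: (neg_part a) (neg_part b) na0 nb0 step na nb sq {nam} => p q p0 q0.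
  move=> step na nb sq; nra.
rewrite RintegralD// RintegralD// RintegralB// !RintegralZl// /energy.
have rearrange (b a d m : R) : d <= 0 -> b - a + d + m <= b + m - a by lra.
by apply: rearrange; rewrite mulr_ge0_le0// mulr_ge0.
Qed.

(** [E(0) = 0] since [k] vanishes on the negative half-line.  Summing the
increments over [n] steps of length [t / n] leaves [E(t) <= C t^2 / n], the
errors being quadratic in the length of the step. *)
Lemma smoothed_ge0 t : 0 <= t <= T -> {ae leb, forall x, 0 <= smoothed t x}.
Proof.
move=> /andP[t0 tT].
pose C := 2 * K * M * \int[leb]_x (mass x ^+ 2).
have C0 : 0 <= C.
  by rewrite /C !mulr_ge0//; apply: Rintegral_ge0 => x _; exact: sqr_ge0.
have start : energy 0 = 0.
  rewrite /energy /Rintegral (eq_integral (cst 0%E)) ?integral0// => x _.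
  rewrite /smoothed /tavg /Rintegral (eq_integral (cst 0%E)) ?integral0/=.
    by rewrite /neg_part oppr0 maxxx expr0n.
  move=> r _; have [rT|rT] := pselect (0 < r < T); last by rewrite u0// mulr0.
  by rewrite k0 ?mul0r// sub0r oppr_le0; case/andP: rT => /ltW.
have bound n j : (j <= n.+1)%N ->
    energy (t / n.+1%:R * j%:R) <= j%:R * (C * (t / n.+1%:R) ^+ 2).
  elim: j => [_|j IH jn]; first by rewrite mulr0 mul0r start.
  set h := t / n.+1%:R in IH *.
  have h0 : 0 <= h by rewrite divr_ge0.
  have -> : h * j.+1%:R = h * j%:R + h by rewrite -natr1 mulrDr mulr1.
  apply: le_trans (energy_increment h0 _) _.
    rewrite addr_ge0 ?mulr_ge0//= (le_trans _ tT)//.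
    have -> : h * j%:R + h = h * j.+1%:R by rewrite -natr1 mulrDr mulr1.
    by rewrite /h mulrAC ler_pdivrMr ?ltr0n// ler_wpM2l// ler_nat.
  have -> : 2 * K * M * h ^+ 2 * \int[leb]_x (mass x ^+ 2) = C * h ^+ 2.
    by rewrite /C mulrAC.
  by rewrite -natr1 mulrDl mul1r lerD2r IH// ltnW.
have alg (q c x : R) : q != 0 -> q * (c * (x / q) ^+ 2) = c * x ^+ 2 / q.
  by move=> q0; field.
have Et0 : energy t <= 0.
  rewrite leNgt; apply/negP => Et.
  pose n := Num.truncn (C * t ^+ 2 / energy t).
  have := bound n n.+1 (leqnn _); rewrite mulfVK ?pnatr_eq0//.
  have -> : n.+1%:R * (C * (t / n.+1%:R) ^+ 2) = C * t ^+ 2 / n.+1%:R.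
    by apply: alg; rewrite pnatr_eq0.
  rewrite ler_pdivlMr ?ltr0n// leNgt => /negP; apply.
  by rewrite [ltRHS]mulrC -ltr_pdivrMr//; exact: truncnS_gt.
have Ie := sqint_integrable_sqr (sneg t).
have int0 : (\int[leb]_x `|(neg_part (smoothed t x) ^+ 2)%:E| = 0)%E.
  transitivity ((energy t)%:E); last first.
    congr EFin; apply/eqP; rewrite eq_le Et0/=.
    by apply: Rintegral_ge0 => x _; exact: sqr_ge0.
  rewrite /energy /Rintegral fineK; last exact: (integrable_fin_num measurableT Ie).
  by apply: eq_integral => x _; rewrite gee0_abs// lee_fin sqr_ge0.
have mI := measurable_int _ Ie.
have := (ae_eq_integral_abs leb measurableT mI).1 int0.
apply: ae_imp => x /(_ I) [] /eqP; rewrite sqrf_eq0 => /eqP nx.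
have : - smoothed t x <= neg_part (smoothed t x) by rewrite le_max lexx.
by rewrite nx oppr_le0.
Qed.

End energy_estimate.

(** * Smoothed indicators of intervals *)

Section smooth_step.
Variable R : realType.

Lemma quadratic_expansionZ (k k' : R -> R) K c : quadratic_expansion k k' K ->
  quadratic_expansion (fun r => c * k r) (fun r => c * k' r) (`|c| * K).
Proof.
move=> kK a b.
have -> : c * k b - c * k a - (b - a) * (c * k' a) = c * (k b - k a - (b - a) * k' a).
  by ring.
by rewrite normrM -mulrA ler_wpM2l.
Qed.

Lemma quadratic_expansionD (k1 k1' : R -> R) K1 (k2 k2' : R -> R) K2 :
  quadratic_expansion k1 k1' K1 -> quadratic_expansion k2 k2' K2 ->
  quadratic_expansion (fun r => k1 r + k2 r) (fun r => k1' r + k2' r) (K1 + K2).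
Proof.
move=> kK1 kK2 a b.
have -> : k1 b + k2 b - (k1 a + k2 a) - (b - a) * (k1' a + k2' a) =
  (k1 b - k1 a - (b - a) * k1' a) + (k2 b - k2 a - (b - a) * k2' a) by ring.
rewrite [leRHS]mulrDl; exact: (le_trans (ler_normD _ _) (lerD (kK1 a b) (kK2 a b))).
Qed.

Lemma quadratic_expansion_shift (k k' : R -> R) K c : quadratic_expansion k k' K ->
  quadratic_expansion (fun r => k (r - c)) (fun r => k' (r - c)) K.
Proof.
move=> kK a b; have := kK (a - c) (b - c).
by have -> : b - c - (a - c) = b - a by ring.
Qed.

Definition pos (x : R) : R := Num.max x 0.

(** The spline [max(r, 0)^2] is the basic function of class [C^{1,1}] from which
the kernels are assembled. *)
Lemma quadratic_expansion_pos2 :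
  quadratic_expansion (fun r => pos r ^+ 2) (fun r => 2 * pos r) 1.
Proof.
move=> a b; rewrite /pos mul1r ler_norml.
have ba := sqr_ge0 (b - a); have b2 := sqr_ge0 b; have a2 := sqr_ge0 a.
have [a0|a0] := leP a 0; have [b0|b0] := leP b 0.
- by rewrite expr0n/= subrr !mulr0 subr0; apply/andP; split; lra.
- have : a * b <= 0 by rewrite mulr_le0_ge0// ltW.
  by rewrite expr0n/= !mulr0 !subr0; move: ba; rewrite sqrrB; lra.
- have : a * b <= 0 by rewrite mulr_ge0_le0// ltW.
  rewrite expr0n/= sub0r (_ : - a ^+ 2 - (b - a) * (2 * a) = a ^+ 2 - 2 * (a * b)).
    by move: ba; rewrite sqrrB; lra.
  by ring.
- rewrite (_ : b ^+ 2 - a ^+ 2 - (b - a) * (2 * a) = (b - a) ^+ 2); last by ring.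
  by apply/andP; split; lra.
Qed.

(** A quadratic spline with knots [0], [dl] and [2 dl], equal to [0] before the
first one and to [1] after the last one: the second difference of
[max(r, 0)^2], normalised. *)
Definition smooth_step (dl r : R) : R := (2 * dl ^+ 2)^-1 *
  (pos r ^+ 2 + - 2 * pos (r - dl) ^+ 2 + pos (r - 2 * dl) ^+ 2).
Definition smooth_step' (dl r : R) : R := (2 * dl ^+ 2)^-1 *
  (2 * pos r + - 2 * (2 * pos (r - dl)) + 2 * pos (r - 2 * dl)).

Variable dl : R.
Hypothesis dl0 : 0 < dl.

Lemma quadratic_expansion_smooth_step :
  exists K, quadratic_expansion (smooth_step dl) (smooth_step' dl) K.
Proof.
have P := quadratic_expansion_pos2.
eexists; apply: quadratic_expansionZ; apply: quadratic_expansionD.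
  apply: quadratic_expansionD; first exact: P.
  exact: (quadratic_expansionZ _ (quadratic_expansion_shift dl P)).
exact: (quadratic_expansion_shift (2 * dl) P).
Qed.

Let c0 : 0 < (2 * dl ^+ 2)^-1. Proof. by rewrite invr_gt0 mulr_gt0// exprn_gt0. Qed.

(** The derivative is the hat function with the same knots. *)
Lemma smooth_step'_bound r : 0 <= smooth_step' dl r <= dl^-1.
Proof.
apply/andP; split.
  rewrite /smooth_step' mulr_ge0 ?(ltW c0)// /pos.
  by have [h1|h1] := leP r 0; have [h2|h2] := leP (r - dl) 0;
    have [h3|h3] := leP (r - 2 * dl) 0; lra.
have h : 2 * pos r + - 2 * (2 * pos (r - dl)) + 2 * pos (r - 2 * dl) <= 2 * dl.
  have dl_gt0 := dl0; rewrite /pos.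
  by have [h1|h1] := leP r 0; have [h2|h2] := leP (r - dl) 0;
    have [h3|h3] := leP (r - 2 * dl) 0; lra.
rewrite /smooth_step' mulrC ler_pdivrMr ?mulr_gt0 ?exprn_gt0//.
by apply: le_trans h _; rewrite mulrCA expr2 mulKf// gt_eqF.
Qed.

Lemma smooth_step_le0 r : r <= 0 -> smooth_step dl r = 0.
Proof.
move=> r0; have dl_gt0 := dl0; rewrite /smooth_step /pos (max_idPr r0).
have -> : Num.max (r - dl) 0 = 0 by apply/max_idPr; lra.
have -> : Num.max (r - 2 * dl) 0 = 0 by apply/max_idPr; lra.
by rewrite expr0n/= mulr0 !addr0 mulr0.
Qed.

Lemma smooth_step_ge r : 2 * dl <= r -> smooth_step dl r = 1.
Proof.
move=> r0; have dl_gt0 := dl0; rewrite /smooth_step /pos.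
have -> : Num.max r 0 = r by apply/max_idPl; lra.
have -> : Num.max (r - dl) 0 = r - dl by apply/max_idPl; lra.
have -> : Num.max (r - 2 * dl) 0 = r - 2 * dl by apply/max_idPl; lra.
by field; rewrite gt_eqF.
Qed.

Lemma smooth_step_homo : {homo smooth_step dl : x y / x <= y}.
Proof.
have [K kK] := quadratic_expansion_smooth_step.
move=> x y xy; apply: (@ger0_derive1_ndecr _ (smooth_step dl) x y) => //.
- by move=> z _; apply: ex_derive; exact: (quadratic_expansion_is_derive kK).
- move=> z _; rewrite derive1E.
  have -> := @derive_val _ _ _ _ _ _ _ (quadratic_expansion_is_derive kK z).
  by have /andP[] := smooth_step'_bound z.
- apply: derivable_within_continuous => z _.
  by apply: ex_derive; exact: (quadratic_expansion_is_derive kK).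
Qed.

Lemma smooth_step_bound r : 0 <= smooth_step dl r <= 1.
Proof.
apply/andP; split.
  have [r0|r0] := leP r 0; first by rewrite smooth_step_le0.
  by rewrite -(smooth_step_le0 (lexx 0)); apply: smooth_step_homo; exact: ltW.
have [r0|r0] := leP (2 * dl) r; first by rewrite smooth_step_ge.
by rewrite -(smooth_step_ge (lexx (2 * dl))); apply: smooth_step_homo; exact: ltW.
Qed.

Variables a b : R.
Hypotheses (a0 : 0 <= a) (ab : a <= b).

(** As [dl] goes to [0], the indicator of the interval [a < r <= b]. *)
Definition plateau (r : R) : R := smooth_step dl (r - a) + - 1 * smooth_step dl (r - b).
Definition plateau' (r : R) : R := smooth_step' dl (r - a) + - 1 * smooth_step' dl (r - b).

Lemma quadratic_expansion_plateau : exists K, quadratic_expansion plateau plateau' K.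
Proof.
have [K kK] := quadratic_expansion_smooth_step.
eexists; apply: quadratic_expansionD.
  exact: (quadratic_expansion_shift a kK).
exact: (quadratic_expansionZ _ (quadratic_expansion_shift b kK)).
Qed.

Lemma plateau_ge0 r : 0 <= plateau r.
Proof. by rewrite /plateau mulN1r subr_ge0 smooth_step_homo// lerD2l lerN2. Qed.

Lemma plateau_norm r : `|plateau r| <= 1 + dl^-1.
Proof.
have d0 : 0 < dl^-1 by rewrite invr_gt0.
rewrite ger0_norm ?plateau_ge0// /plateau.
by have := smooth_step_bound (r - a); have := smooth_step_bound (r - b); lra.
Qed.

Lemma plateau'_norm r : `|plateau' r| <= 1 + dl^-1.
Proof.
have d0 : 0 < dl^-1 by rewrite invr_gt0.
rewrite ler_norml /plateau'.
by have := smooth_step'_bound (r - a); have := smooth_step'_bound (r - b); lra.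
Qed.

Lemma plateau_le0 r : r <= 0 -> plateau r = 0.
Proof.
move=> r0; have := a0; have := ab => h1 h2.
by rewrite /plateau !smooth_step_le0 ?mulr0 ?addr0//; lra.
Qed.

Lemma plateau_norm_le1 r : `|plateau r| <= 1.
Proof.
rewrite ger0_norm ?plateau_ge0// /plateau.
by have := smooth_step_bound (r - a); have := smooth_step_bound (r - b); lra.
Qed.

Lemma measurable_plateau : measurable_fun setT plateau.
Proof.
have [K kK] := quadratic_expansion_plateau.
apply: continuous_measurable_fun => t.
apply/differentiable_continuous/derivable1_diffP/ex_derive.
exact: (quadratic_expansion_is_derive kK).
Qed.

End smooth_step.

Section limit.
Variable R : realType.
Local Notation L1 := (@lebesgue_measure R).

Lemma smooth_step_cvg (r : R) : smooth_step (n.+1%:R^-1) r @[n --> \oo] --> ((0 < r)%R%:R : R).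
Proof.
have [r0|r0] := ltP 0 r; last first.
  by under eq_fun do rewrite smooth_step_le0//; exact: cvg_cst.
apply: cvg_near_cst; near=> n.
rewrite smooth_step_ge// ler_pdivrMr ?ltr0n// mulrC -ler_pdivrMr//.
apply: ltW; apply: lt_le_trans (truncnS_gt _) _.
by rewrite ler_nat ltnS; near: n; exact: nbhs_infty_ge.
Unshelve. all: by end_near. Qed.

(** Dominated convergence.  Reversing the time turns the limit indicator of
[a < T - r <= b] into that of [T - b <= r < T - a]. *)
Lemma plateau_integral_limit (f : R -> R) (T a b : R) :
  L1.-integrable setT (EFin \o f) -> a <= b ->
  (forall n, 0 <= \int[L1]_r (plateau (n.+1%:R^-1) a b (T - r) * f r)) ->
  0 <= \int[L1]_(r in `[T - b, T - a[) f r.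
Proof.
move=> If ab pos_n.
have mf : measurable_fun setT f by apply/measurable_EFinP; exact: (measurable_int _ If).
have d0 (n : nat) : (0 : R) < n.+1%:R^-1 by rewrite invr_gt0.
have mp n : measurable_fun setT (fun r : R => plateau (n.+1%:R^-1) a b (T - r)).
  have mT : measurable_fun setT (fun r : R => T - r) by apply: measurable_funB.
  exact: (measurableT_comp (measurable_plateau _ a b) mT).
pose F := fun n r => (plateau (n.+1%:R^-1) a b (T - r) * f r)%:E.
have mF n : measurable_fun setT (F n) by apply/measurable_EFinP; exact: measurable_funM.
have FG : {ae L1, forall r, setT r -> F ^~ r @ \oo --> ((f \_ `[T - b, T - a[) r)%:E}.
  apply: aeW => r _; apply: cvg_EFin; first exact: nearW.
  have -> : (f \_ `[T - b, T - a[) r =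
      ((0 < T - r - a)%R%:R + - 1 * (0 < T - r - b)%R%:R) * f r.
    rewrite patchE; case: ifPn; rewrite ?notin_setE ?inE/= in_itv/=.
      move=> /andP[h1 h2]; have -> : 0 < T - r - a by lra.
      by rewrite ltNge (_ : T - r - b <= 0)/= ?mulr0 ?addr0 ?mul1r//; lra.
    have [h1|h1] := ltP 0 (T - r - a); have [h2|h2] := ltP 0 (T - r - b) => h.
    - by rewrite mulr1 subrr mul0r.
    - by exfalso; apply: h; lra.
    - by exfalso; lra.
    - by rewrite mulr0 addr0 mul0r.
  apply: cvgMl; apply: cvgD; first exact: smooth_step_cvg.
  by apply: cvgMr; exact: smooth_step_cvg.
have Fdom : {ae L1, forall r n, setT r -> (`|F n r| <= `|(f r)%:E|)%E}.
  apply: aeW => r n _; rewrite /F lee_fin normrM ler_piMl//.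
  exact: plateau_norm_le1 (d0 n) _ _ _ _.
have mG : measurable_fun setT (EFin \o (f \_ `[T - b, T - a[)).
  by apply/measurable_EFinP/(measurable_restrictT _ _).1 => //; exact: measurable_funTS.
have [_ _ lim] := @dominated_convergence _ (measurableTypeR R) R L1 setT measurableT
  F _ _ mF mG FG (integrable_abse If) Fdom.
rewrite Rintegral_mkcond; apply: fine_ge0.
rewrite -(cvg_lim _ lim)//; apply: lime_ge; first by apply/cvg_ex; eexists; exact: lim.
apply: nearW => n.
have IF : L1.-integrable setT (F n).
  apply: (le_integrable measurableT _ _ (integrable_abse If)); first exact: mF.
  move=> r _.
  rewrite /F/= normr_id lee_fin normrM ler_piMl//.
  exact: plateau_norm_le1 (d0 n) _ _ _ _.
have := pos_n n; rewrite -lee_fin /Rintegral fineK//.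
exact: (integrable_fin_num measurableT IF).
Qed.

(** The primitive of [f] is nondecreasing along rationals.  At a point [t] where
its derivative is [f t < 0] it would be larger at some rational [c < t] than at
[t], and larger at [t] than at some rational [d > t]. *)
Lemma ae_ge0_of_rational_integrals (f : R -> R) (T : R) :
  L1.-integrable setT (EFin \o f) ->
  (forall c d : rat, 0 < ratr c :> R -> ratr c < ratr d :> R -> ratr d < T ->
    0 <= \int[L1]_(r in `[ratr c, ratr d[) f r) ->
  {ae L1, forall t, 0 < t < T -> 0 <= f t}.
Proof.
move=> If cd.
have Iy (D : set R) : measurable D -> L1.-integrable D (EFin \o f).
  by move=> mD; apply: integrableS If.
have locf : locally_integrable [set: R] f.
  have := integrable_locally measurableT If.
  by congr locally_integrable; rewrite patch_setT.
pose F y := \int[L1]_(t in `]-oo, y]) f t.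
have := FTC1Ny (fun y => Iy _ (measurable_itv _)) locf.
apply: ae_imp => t [dF Ft] /andP[t0 tT]; rewrite leNgt; apply/negP => ft.
have Fmono (c d : rat) : 0 < ratr c :> R -> ratr c < ratr d :> R -> ratr d < T ->
    F (ratr c) <= F (ratr d).
  move=> c0 cdlt dT; rewrite -subr_ge0 /F Rintegral_itvB//; last 2 first.
  - exact: Iy.
  - by rewrite bnd_simp ltW.
  rewrite Rintegral_itv_obnd_cbnd; last exact: Iy.
  by rewrite -Rintegral_itv_bndo_bndc; [exact: cd|exact: Iy].
have : \forall h \near 0^', h^-1 *: (F (h *: 1 + t) - F t) < 0.
  have cvF : h^-1 *: (F (h *: 1 + t) - F t) @[h --> 0^'] --> f t.
    by rewrite -Ft derive1E; exact: dF.
  exact: (cvgr_lt _ cvF).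
move=> [e /= e0 He].
have quot h : h != 0 -> `|h| < e -> h^-1 * (F (t + h) - F t) < 0.
  move=> h0 he; have := He h; rewrite /= sub0r normrN => /(_ he h0).
  by rewrite /GRing.scale/= mulr1 (addrC h).
have [d] : exists d : rat, t < ratr d < Num.min (t + e) T.
  have /rat_in_itvoo[d /itvP hd] : t < Num.min (t + e) T by rewrite lt_min ltrDl e0.
  by exists d; apply/andP; split; rewrite hd.
rewrite lt_min => /andP[td /andP[dte dT]].
have [c] : exists c : rat, Num.max (t - e) 0 < ratr c < t.
  have /rat_in_itvoo[c /itvP hc] : Num.max (t - e) 0 < t by rewrite gt_max t0 andbT ltrBlDr ltrDl.
  by exists c; apply/andP; split; rewrite hc.
rewrite gt_max => /andP[/andP[tec c0] ct].
have shift (q : R) : t + (q - t) = q by rewrite addrC subrK.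
have Fd : F (ratr d) < F t.
  have dt : ratr d - t < e by rewrite ltrBlDl.
  have := quot (ratr d - t); rewrite shift gtr0_norm ?subr_gt0// subr_eq0 gt_eqF//.
  by move=> /(_ isT dt); rewrite pmulr_rlt0 ?invr_gt0 ?subr_gt0// subr_lt0.
have Fc : F t < F (ratr c).
  have tc : t - ratr c < e by rewrite ltrBlDl -ltrBlDr.
  have := quot (ratr c - t); rewrite shift ltr0_norm ?subr_lt0// opprB subr_eq0 lt_eqF//.
  by move=> /(_ isT tc); rewrite nmulr_rlt0 ?invr_lt0 ?subr_lt0// subr_gt0.
have := Fmono c d c0 (lt_trans ct td) dT.
by rewrite leNgt (lt_trans Fd Fc).
Qed.

End limit.

(** * The comparison principle *)

Lemma ae_forall_countable d (X : measurableType d) (R : realType)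
    (mu : {measure set X -> \bar R}) (I : countType) (P : I -> X -> Prop) :
  (forall i, {ae mu, forall x, P i x}) -> {ae mu, forall x, forall i, P i x}.
Proof.
move=> aeP.
have : {ae mu, forall x, forall n : nat, forall i, unpickle n = Some i -> P i x}.
  apply/ae_foralln => n; case E : (unpickle n) => [i|]; last exact: aeW.
  by apply: ae_imp (aeP i) => x Px j [<-].
by apply: ae_imp => x Px i; apply: (Px (pickle i)); rewrite pickleK.
Qed.

Section positivity.
Context (R : realType) (N : nat) (Omega : set 'rV[R]_N) (s T : R).
Hypotheses (s01 : 0 < s < 1) (T0 : 0 < T).
Local Notation E := 'rV[R]_N.
Local Notation leb := (@lebesgue_rV R N).
Local Notation L1 := (@lebesgue_measure R).

(** Rational endpoints and kernel widths [1/n] make countably many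
inequalities, which hold simultaneously for almost every [x]; the smoothed curve
is evaluated at the final time [T] only. *)
Lemma supersolution_ge0 (u : E * R -> R) :
  finite_energy Omega s T u -> supersolution Omega s T u ->
  {ae (leb \x L1)%E, forall p, 0 < p.2 < T -> 0 <= u p}.
Proof.
move=> fu super; have [u0 su _ _] := fu.
have one_bd (t : R) : `|(fun=> 1 : R) t| <= 1 by rewrite normr1.
have aeI := ae_integrable_tavg su u0 (measurable_cst _) one_bd.
have aeq : {ae leb, forall x, forall i : rat * rat * nat,
    let a := T - ratr i.1.2 in let b := T - ratr i.1.1 in
    0 <= a -> a <= b ->
    0 <= tavg (fun r => plateau (i.2.+1%:R^-1) a b (T - r)) u x}.
  apply: ae_forall_countable => -[[c d] n] /=.
  have [a0|a0] := leP 0 (T - ratr d); last exact: aeW.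
  have [ab|ab] := leP (T - ratr d) (T - ratr c); last exact: aeW.
  have d0 : (0 : R) < n.+1%:R^-1 by rewrite invr_gt0.
  have [K kK] := quadratic_expansion_plateau (n.+1%:R^-1) (T - ratr d) (T - ratr c).
  have TT : 0 <= T <= T by rewrite lexx ltW.
  have := smoothed_ge0 s01 fu super kK (plateau_ge0 d0 ab)
    (plateau_norm d0 ab) (plateau'_norm d0 _ _) (plateau_le0 d0 a0 ab) TT.
  by apply: ae_imp => x ux _ _; exact: ux.
apply: ae_prod_x.
  have mA : measurable [set p : E * measurableTypeR R | 0 < p.2 < T].
    have -> : [set p : E * measurableTypeR R | 0 < p.2 < T] = setT `*` `]0, T[.
      by apply/seteqP; split => -[x t] /=; rewrite in_itv/=; [split|case].
    by apply: measurableX => //; exact: measurable_itv.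
  have -> : [set p : E * R | ~ (0 < p.2 < T -> 0 <= u p)] =
      [set p : E * measurableTypeR R | 0 < p.2 < T] `&` (u @^-1` `]-oo, 0[).
    apply/seteqP; split => p /=; rewrite in_itv/=.
      by move=> /not_implyP[pT /negP]; rewrite -ltNge.
    by move=> [pT up]; apply/not_implyP; split => //; apply/negP; rewrite -ltNge.
  apply: measurableI => //.
  by rewrite -[X in measurable X]setTI; apply: (proj1 su) => //; exact: measurable_itv.
apply: ae_imp2 aeI aeq => x Ix qx.
have Iux : L1.-integrable setT (fun t => (u (x, t))%:E).
  by move: Ix; apply: eq_integrable => // t _; rewrite mul1r.
apply: (ae_ge0_of_rational_integrals Iux) => c d c0 cd dT.
have := @plateau_integral_limit _ (fun t => u (x, t)) T (T - ratr d) (T - ratr c) Iux.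
rewrite !opprB !addrA !(addrC T) !addrK; apply; first by rewrite lerD2r lerN2 ltW.
move=> n; have := qx (c, d, n); rewrite /= subr_ge0 lerD2l lerN2.
by rewrite /tavg (addrC T) (addrC T) => /(_ (ltW dT) (ltW cd)).
Qed.

(** The faces [t = 0] and [t = T] are null sets. *)
Lemma ae_strip (P : E * R -> Prop) :
  {ae (leb \x L1)%E, forall p, 0 < p.2 < T -> P p} ->
  {ae (leb \x L1)%E, forall p, 0 <= p.2 <= T -> P p}.
Proof.
have h0 : {ae L1, forall t, t <> 0}.
  exists [set 0]; split=> [//||t /= /contrapT ->//]; exact: lebesgue_measure_set1.
have hT : {ae L1, forall t, t <> T}.
  exists [set T]; split=> [//||t /= /contrapT ->//]; exact: lebesgue_measure_set1.
have := ae_imp2 (fun t a b => conj a b) h0 hT => /(ae_snd leb).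
apply: ae_imp2 => p [/eqP p0 /eqP pT] Pp /andP[p0' pT'].
by apply: Pp; rewrite !lt_neqAle p0' pT' pT eq_sym p0.
Qed.

End positivity.

Theorem theorem4p2 (R : realType) (N : nat) (Omega : set 'rV[R]_N) (s T : R)
    (N_ge1 : (1 <= N)%N) (Omega_dom : bounded_lipschitz_domain Omega)
    (s01 : 0 < s < 1) (T_gt0 : 0 < T)
    (f : 'rV[R]_N * R -> R) (rho0 : 'rV[R]_N -> R) (rho : 'rV[R]_N * R -> R)
    (f_L2 : L2_Q Omega T f) (rho0_L2 : L2_Omega Omega rho0)
    (rho_sol : weak_solution Omega s T f rho0 rho) :
  (forall (f' : 'rV[R]_N * R -> R) (rho0' : 'rV[R]_N -> R)
      (rho' : 'rV[R]_N * R -> R),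
    L2_Q Omega T f' -> L2_Omega Omega rho0' ->
    weak_solution Omega s T f' rho0' rho' ->
    {ae @lebesgue_rV R N, forall x, Omega x -> rho0 x <= rho0' x} ->
    {ae (@lebesgue_rV R N \x @lebesgue_measure R)%E, forall p,
      cylinder Omega T p -> f p <= f' p} ->
    {ae (@lebesgue_rV R N \x @lebesgue_measure R)%E, forall p,
      0 <= p.2 <= T -> rho p <= rho' p}) /\
  ({ae (@lebesgue_rV R N \x @lebesgue_measure R)%E, forall p,
      cylinder Omega T p -> 0 <= f p} ->
   {ae @lebesgue_rV R N, forall x, Omega x -> 0 <= rho0 x} ->
   {ae (@lebesgue_rV R N \x @lebesgue_measure R)%E, forall p,
      0 <= p.2 <= T -> 0 <= rho p}).
Proof.
have [_ oO _ bO _] := Omega_dom.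
have fe := L2_Hs0_finite_energy s01 N_ge1 oO bO (proj1 (proj1 rho_sol)).
have stripE (g : 'rV[R]_N * R -> R) p : 0 < p.2 < T -> (g \_ (@strip R N T)) p = g p.
  by move=> pT; rewrite patchE mem_set//; split => //=; rewrite in_itv.
split=> [f' rho0' rho' f'_L2 rho0'_L2 rho'_sol rr ff|f_ge0 rho0_ge0]; apply: ae_strip.
  have fe' := L2_Hs0_finite_energy s01 N_ge1 oO bO (proj1 (proj1 rho'_sol)).
  have := supersolution_ge0 s01 T_gt0 (finite_energyB fe' fe)
    (supersolution_of_difference s01 T_gt0 N_ge1 oO bO f_L2 rho0_L2 rho_sol
      f'_L2 rho0'_L2 rho'_sol ff rr).
  by apply: ae_imp => p pge pT; have := pge pT; rewrite !stripE// subr_ge0.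
have := supersolution_ge0 s01 T_gt0 fe
  (supersolution_of_solution s01 T_gt0 N_ge1 oO bO f_L2 rho0_L2 rho_sol f_ge0 rho0_ge0).
by apply: ae_imp => p pge pT; have := pge pT; rewrite stripE.
Qed.
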